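(* Let $H$ be a group for which there exist: (T1) a short exact sequence of groups $1\to F\to H\to A\to 1$ such that $F$ is a free non-abelian group and $A$ is a group satisfying a non-trivial law $I_A$; (T2) a divisible subgroup $Q$ of $H$ such that $Q\subseteq Z(H)$ and $Q\cap H'=\{1\}$; (T3) a generating set $U=U^{-1}$ of $H$ such that for any $u\in U$ there are finitely many elements $$E_{u,k}(x,I_A(H))\in I_A(\langle x\rangle_\infty)\cdot I_A(H)^{\langle x\rangle_\infty\ast I_A(H)},\qquad k=1,\dots,n_u,$$ such that the system of equations (in the unknown $x$) $$\{E_{u,k}(x,I_A(H))=E_{u,k}(u,I_A(H))\ |\ k=1,\dots,n_u\}$$ has a unique solution in $H/Q$. Then $H$ is strongly verbally closed.
   Context: $F_n(x_1,\dots,x_n)$ is the free group with basis $x_1,\dots,x_n$. A subgroup $H$ of a group $G$ is verbally closed in $G$ if any equation $w(x_1,\dots,x_n)=h$ with $w\in F_n(x_1,\dots,x_n)$ and $h\in H$ having a solution in $G$ has a solution in $H$. A subgroup $H$ of $G$ is algebraically closed in $G$ if any finite system of equations $\{w_1(x_1,\dots,x_n,H)=1,\dots,w_m(x_1,\dots,x_n,H)=1\}$ with $w_i(x_1,\dots,x_n,H)\in F_n(x_1,\dots,x_n)\ast H$ having a solution in $G$ has a solution in $H$. A group $H$ is strongly verbally closed if $H$ is algebraically closed in any group containing $H$ as a verbally closed subgroup. A group $A$ satisfies the law $I\in F_r(x_1,\dots,x_r)$ if $I(g_1,\dots,g_r)=1$ for all $g_1,\dots,g_r\in A$; the law is non-trivial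 if $I\neq 1$ in $F_r$. For a word $I\in F_r(x_1,\dots,x_r)$ and a group $G$, the verbal subgroup is $I(G)=\langle I(g_1,\dots,g_r)\mid g_1,\dots,g_r\in G\rangle$. $\langle x\rangle_\infty$ is the infinite cyclic group generated by $x$; $\ast$ is the free product; $A^B$ is the normal closure of a subgroup $A$ in a group $B$; for subgroups $A,B$ of a group, $A\cdot B=\langle ab\mid a\in A,\ b\in B\rangle$. $Z(H)$ and $H'$ are the center and the derived subgroup of $H$. For $E(x,I_A(H))\in\langle x\rangle_\infty\ast I_A(H)$ and $g\in H$, $E(g,I_A(H))\in H$ is the image of $E$ under the homomorphism $\langle x\rangle_\infty\ast I_A(H)\to H$ sending $x$ to $g$ and restricting to the inclusion on $I_A(H)$. A solution in $H/Q$ of the system in (T3) is a coset $gQ$ such that $E_{u,k}(g,I_A(H))\,Q=E_{u,k}(u,I_A(H))\,Q$ in $H/Q$ for all $k=1,\dots,n_u$. *)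

(* Defs.v *)
From HB Require Import structures.
From mathcomp Require Import all_boot generic_quotient.
From mathcomp Require Import boolp classical_sets.

Set Implicit Arguments.
Unset Strict Implicit.
Unset Printing Implicit Defensive.

Local Open Scope classical_set_scope.
Local Open Scope quotient_scope.
Local Open Scope group_scope.

(** Groups are MathComp's [groupType], and subsets of a group are [set G].
    [groupType] includes a choice structure, which every type has classically
    ([boolp.gen_choiceMixin]), so it covers all (possibly infinite) groups. *)

Section Subgroups.
Variable G : groupType.
Implicit Types A B : set G.

Definition subgroup A : Prop := group_closed (mem A).

Definition normal_subgroup A : Prop :=
  subgroup A /\ forall x g, A x -> A (x ^ g).

Definition generated A : set G := smallest subgroup A.

Definition normal_closure A : set G := smallest normal_subgroup A.

(* A . B: the subgroup generated by the products, not just their set. *)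
Definition sgprod A B : set G := generated [set a * b | a in A & b in B].

Definition lcoset (g : G) A : set G := [set g * a | a in A].

Definition center : set G := [set z | forall x : G, commute z x].

Definition derived : set G :=
  generated [set [~ x, y] | x in [set: G] & y in [set: G]].

Definition divisible A : Prop :=
  forall n x, 0 < n -> A x -> exists2 y, A y & y ^+ n = x.

Lemma subgroup_generated A : subgroup (generated A).
Proof.
split; first by apply/mem_set => B [[B1 _] _]; apply: set_mem.
move=> x y /set_mem Ax /set_mem Ay; apply/mem_set => B [sB AB]; apply: set_mem.
by apply: sB.2; apply/mem_set; [apply: Ax|apply: Ay].
Qed.

(* The subgroup generated by A, as a group in its own right. *)
Record generated_group A := GeneratedGroup {
  generated_val : G;
  _ : generated_val \in generated A
}.

HB.instance Definition _ A := [isSub for @generated_val A].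
HB.instance Definition _ A := [Choice of generated_group A by <:].
HB.instance Definition _ A :=
  @SubChoice_isSubGroup.Build G (fun x => x \in generated A)
    (generated_group A) (subgroup_generated A).

End Subgroups.

Arguments center : clear implicits.
Arguments derived : clear implicits.

(* A letter (x, false) stands for x and (x, true) for x^-1. *)
Definition word (X : Type) := seq (X * bool).

Definition inv_word X (w : word X) : word X :=
  rev [seq (p.1, ~~ p.2) | p <- w].

Definition eval_word X (G : groupType) (f : X -> G) (w : word X) : G :=
  \prod_(p <- w) (if p.2 then (f p.1)^-1 else f p.1).

Inductive word_eq (X : Type) (R : word X -> Prop) : word X -> word X -> Prop :=
| word_eq_refl u : word_eq R u u
| word_eq_sym u v : word_eq R u v -> word_eq R v u
| word_eq_trans u v w : word_eq R u v -> word_eq R v w -> word_eq R u w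
| word_eq_cat u u' v v' :
    word_eq R u u' -> word_eq R v v' -> word_eq R (u ++ v) (u' ++ v')
| word_eq_cancel x b : word_eq R [:: (x, b); (x, ~~ b)] [::]
| word_eq_relator r : R r -> word_eq R r [::].

Section Presented.
Variables (X : choiceType) (R : word X -> Prop).

Definition word_eqb : rel (word X) := fun u v => `[< word_eq R u v >].

Lemma word_eqb_equiv : equiv_class_of word_eqb.
Proof.
split=> [u|u v|v u w /asboolP uv /asboolP vw].
- exact/asboolP/word_eq_refl.
- by apply/asboolP/asboolP; apply: word_eq_sym.
- by apply/asboolP; apply: word_eq_trans uv vw.
Qed.

Canonical word_eqb_rel := EquivRelPack word_eqb_equiv.

(* The group < X | R >. *)
Definition presented : Type := {eq_quot word_eqb}.

HB.instance Definition _ := Choice.on presented.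
HB.instance Definition _ := EqQuotient.on presented.

Definition word_class (w : word X) : presented := \pi_presented w.

Lemma word_classP u v : word_class u = word_class v <-> word_eq R u v.
Proof. by split=> [/eqmodP /asboolP|uv] //; apply/eqmodP/asboolP. Qed.

Lemma repr_word_class w : word_eq R (repr (word_class w)) w.
Proof. by apply/word_classP; rewrite /word_class reprK. Qed.

Definition pres_mul (a b : presented) := word_class (repr a ++ repr b).
Definition pres_inv (a : presented) := word_class (inv_word (repr a)).

Lemma pres_mulE u v :
  pres_mul (word_class u) (word_class v) = word_class (u ++ v).
Proof. by apply/word_classP; apply: word_eq_cat; apply: repr_word_class. Qed.

Lemma word_eq_invl u : word_eq R (inv_word u ++ u) [::].
Proof.
elim: u => [|[x b] u IHu] /=; first exact: word_eq_refl.
rewrite /inv_word /= rev_cons cat_rcons.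
apply: word_eq_trans IHu; apply: word_eq_cat; first exact: word_eq_refl.
rewrite -[(x, ~~ b) :: _]/([:: (x, ~~ b); (x, b)] ++ u) -[X in word_eq _ _ X]cat0s.
apply: word_eq_cat; last exact: word_eq_refl.
by have := word_eq_cancel R x (~~ b); rewrite negbK.
Qed.

Lemma inv_wordK : involutive (@inv_word X).
Proof.
move=> u; rewrite /inv_word map_rev revK -map_comp -[RHS]map_id.
by apply: eq_map => -[x b] /=; rewrite negbK.
Qed.

Lemma pres_mulA : associative pres_mul.
Proof.
move=> a b c; rewrite -[a]reprK -[b]reprK -[c]reprK -!/(word_class _).
by rewrite !pres_mulE catA.
Qed.

Lemma pres_mul1 : left_id (word_class [::]) pres_mul.
Proof. by move=> a; rewrite -[a]reprK -/(word_class _) pres_mulE. Qed.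

Lemma pres_mulr1 : right_id (word_class [::]) pres_mul.
Proof. by move=> a; rewrite -[a]reprK -/(word_class _) pres_mulE cats0. Qed.

Lemma pres_mulV : left_inverse (word_class [::]) pres_inv pres_mul.
Proof.
move=> a; rewrite -{2}[a]reprK -/(word_class _) pres_mulE.
exact/word_classP/word_eq_invl.
Qed.

Lemma pres_mulrV : right_inverse (word_class [::]) pres_inv pres_mul.
Proof.
move=> a; rewrite -{1}[a]reprK -/(word_class _) pres_mulE.
by apply/word_classP; rewrite -{1}[repr a]inv_wordK; apply: word_eq_invl.
Qed.

HB.instance Definition _ := isGroup.Build presented
  pres_mulA pres_mul1 pres_mulr1 pres_mulV pres_mulrV.

Definition pres_gen (x : X) : presented := word_class [:: (x, false)].

Lemma word_class_cat u v : word_class (u ++ v) = word_class u * word_class v.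
Proof. by symmetry; apply: pres_mulE. Qed.

Lemma word_classE w : word_class w = eval_word pres_gen w.
Proof.
elim: w => [|[x b] w IHw]; first by rewrite /eval_word big_nil.
rewrite -cat1s word_class_cat IHw /eval_word big_cons; congr (_ * _).
case: b => //=; apply: (@mulIg _ (pres_gen x)); rewrite mulVg -word_class_cat.
exact/word_classP/word_eq_cancel.
Qed.

(* The homomorphism from < X | R > to G extending f; it does not depend on the
   chosen representative as soon as f sends the relators to 1. *)
Definition pres_lift (G : groupType) (f : X -> G) (a : presented) : G :=
  eval_word f (repr a).

Section Lift.
Variables (G : groupType) (f : X -> G).
Hypothesis fR : forall r, R r -> eval_word f r = 1.

Lemma eval_word_eq u v : word_eq R u v -> eval_word f u = eval_word f v.
Proof.
elim=> {u v} [//|u v _ -> //|u v w _ -> _ -> //|u u' v v' _ eu _ ev|x b|s /fR ->].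
- by rewrite /eval_word !big_cat /= -/(eval_word f _) eu -/(eval_word f _) ev.
- rewrite /eval_word !big_cons !big_nil mulg1.
  by case: b => /=; rewrite ?mulVg ?mulgV.
- by rewrite /eval_word big_nil.
Qed.

Lemma pres_liftE w : pres_lift f (word_class w) = eval_word f w.
Proof. exact/eval_word_eq/repr_word_class. Qed.

Lemma pres_liftM : {morph pres_lift f : a b / a * b}.
Proof.
move=> a b; rewrite -[a]reprK -[b]reprK -!/(word_class _).
rewrite [LHS](congr1 (pres_lift f) (pres_mulE _ _)) !pres_liftE.
by rewrite /eval_word big_cat.
Qed.

Lemma pres_lift_gen x : pres_lift f (pres_gen x) = f x.
Proof. by rewrite pres_liftE /eval_word big_seq1. Qed.

End Lift.
End Presented.

Definition freeGroup (X : choiceType) : groupType :=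
  presented (fun _ : word X => False).

Definition free_gen (X : choiceType) (x : X) : freeGroup X := pres_gen _ x.

(* The value w(g) of a word w at a tuple g of elements of G. *)
Definition subst (X : choiceType) (G : groupType) (g : X -> G)
  (w : freeGroup X) : G := pres_lift g w.

Lemma substM (X : choiceType) (G : groupType) (g : X -> G) :
  {morph subst g : v w / v * w}.
Proof. exact: pres_liftM. Qed.

Lemma subst_gen (X : choiceType) (G : groupType) (g : X -> G) x :
  subst g (free_gen x) = g x.
Proof. exact: pres_lift_gen. Qed.

HB.instance Definition _ (X : choiceType) (G : groupType) (g : X -> G) :=
  isMultiplicative.Build (freeGroup X) G (subst g) (substM g).

Definition is_free (F : groupType) : Prop :=
  exists (X : choiceType) (f : {multiplicative freeGroup X -> F}), bijective f.

(* The generators are the elements of both factors; the relators are their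
   multiplication tables. *)
Inductive free_prod_relator (A B : groupType) : word (A + B)%type -> Prop :=
| free_prod_relator_l a a' : free_prod_relator
    [:: (inl a, false); (inl a', false); (inl (a * a'), true)]
| free_prod_relator_r b b' : free_prod_relator
    [:: (inr b, false); (inr b', false); (inr (b * b'), true)].

Definition freeProd (A B : groupType) : groupType :=
  presented (@free_prod_relator A B).

Section FreeProd.
Variables A B : groupType.

Definition fp_inl (a : A) : freeProd A B := pres_gen _ (inl a).
Definition fp_inr (b : B) : freeProd A B := pres_gen _ (inr b).

Definition fp_lift (G : groupType) (f : A -> G) (g : B -> G) :
    freeProd A B -> G :=
  @pres_lift _ (@free_prod_relator A B) G
    (fun s => match s with inl a => f a | inr b => g b end).

Lemma fp_relatorP (G : groupType) (f : A -> G) (g : B -> G) :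
  {morph f : x y / x * y} -> {morph g : x y / x * y} ->
  forall r, free_prod_relator r ->
    eval_word (fun s => match s with inl a => f a | inr b => g b end) r = 1.
Proof.
move=> fM gM _ [a a'|b b']; rewrite /eval_word !big_cons big_nil /= mulg1.
  by rewrite fM mulgA mulgV.
by rewrite gM mulgA mulgV.
Qed.

Lemma fp_liftM (G : groupType)
    (f : {multiplicative A -> G}) (g : {multiplicative B -> G}) :
  {morph fp_lift f g : x y / x * y}.
Proof. by apply: pres_liftM; apply: fp_relatorP; apply: gmulfM. Qed.

Lemma fp_lift_inl (G : groupType)
    (f : {multiplicative A -> G}) (g : {multiplicative B -> G}) a :
  fp_lift f g (fp_inl a) = f a.
Proof. by apply: pres_lift_gen; apply: fp_relatorP; apply: gmulfM. Qed.

Lemma fp_lift_inr (G : groupType)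
    (f : {multiplicative A -> G}) (g : {multiplicative B -> G}) b :
  fp_lift f g (fp_inr b) = g b.
Proof. by apply: pres_lift_gen; apply: fp_relatorP; apply: gmulfM. Qed.

Lemma fp_inlM : {morph fp_inl : a a' / a * a'}.
Proof.
move=> a a'; have /word_eq_relator/word_classP := free_prod_relator_l B a a'.
rewrite word_classE /eval_word !big_cons big_nil /= mulg1 mulgA.
by move/(canRL (mulgVK _)); rewrite mul1g.
Qed.

Lemma fp_inrM : {morph fp_inr : b b' / b * b'}.
Proof.
move=> b b'; have /word_eq_relator/word_classP := free_prod_relator_r A b b'.
rewrite word_classE /eval_word !big_cons big_nil /= mulg1 mulgA.
by move/(canRL (mulgVK _)); rewrite mul1g.
Qed.

HB.instance Definition _ :=
  isMultiplicative.Build A (freeProd A B) fp_inl fp_inlM.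
HB.instance Definition _ :=
  isMultiplicative.Build B (freeProd A B) fp_inr fp_inrM.
HB.instance Definition _ (G : groupType)
    (f : {multiplicative A -> G}) (g : {multiplicative B -> G}) :=
  isMultiplicative.Build (freeProd A B) G (fp_lift f g) (fp_liftM f g).

End FreeProd.

Arguments fp_inl {A B}.
Arguments fp_inr {A B}.

Definition satisfies_law (A : groupType) r (I : freeGroup 'I_r) : Prop :=
  forall g : 'I_r -> A, subst g I = 1.

Definition verbal r (I : freeGroup 'I_r) (G : groupType) : set G :=
  generated [set subst g I | g in [set: 'I_r -> G]].

Arguments verbal {r} I G.

Definition verbal_group r (I : freeGroup 'I_r) (G : groupType) : groupType :=
  generated_group [set subst g I | g in [set: 'I_r -> G]].

(** A group G containing H is given by an embedding i : H -> G, so that the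
    definitions below say that the subgroup i(H) of G is verbally, respectively
    algebraically, closed. *)

Section Closed.
Variables (H G : groupType) (i : {multiplicative H -> G}).

Definition verbally_closed : Prop :=
  forall (n : nat) (w : freeGroup 'I_n) (h : H),
    (exists g : 'I_n -> G, subst g w = i h) ->
    exists g : 'I_n -> H, subst g w = h.

(* The value in K of w(x_1, ..., x_n, H) at x_j := g j, the coefficients being
   sent to K by c. *)
Definition eval_eqn (K : groupType) n (c : H -> K) (g : 'I_n -> K)
  (w : freeProd (freeGroup 'I_n) H) : K := fp_lift (subst g) c w.

Definition algebraically_closed : Prop :=
  forall (n m : nat) (w : 'I_m -> freeProd (freeGroup 'I_n) H),
    (exists g : 'I_n -> G, forall k, eval_eqn i g (w k) = 1) ->
    exists g : 'I_n -> H, forall k, eval_eqn id g (w k) = 1.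

End Closed.

Definition strongly_verbally_closed (H : groupType) : Prop :=
  forall (G : groupType) (i : {multiplicative H -> G}),
    injective i -> verbally_closed i -> algebraically_closed i.

(* 1 -> F -> H -> A -> 1 *)
Definition short_exact (F H A : groupType)
    (i : {multiplicative F -> H}) (p : {multiplicative H -> A}) : Prop :=
  [/\ injective i, range i = [set h | p h = 1] & range p = [set: A]].

Definition non_abelian (F : groupType) : Prop :=
  ~ forall x y : F, commute x y.

Definition infinite_cyclic : groupType := freeGroup unit.

Section OneVariable.
Variables (H : groupType) (r : nat) (I : freeGroup 'I_r).

(* <x>_oo * I(H) *)
Definition one_var_words : groupType :=
  freeProd infinite_cyclic (verbal_group I H).

(* I(<x>_oo) . I(H)^(<x>_oo * I(H)) *)
Definition admissible : set one_var_words :=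
  sgprod (fp_inl @` verbal I infinite_cyclic) (normal_closure (range fp_inr)).

Definition eval_at (g : H) (E : one_var_words) : H :=
  fp_lift (subst (fun _ : unit => g)) (val : verbal_group I H -> H) E.

(* C is a solution in H/Q of the system E_k(x) = E_k(u); the elements of H/Q
   are the cosets g Q. *)
Definition coset_solution (Q : set H) (u : H) n (E : 'I_n -> one_var_words)
    (C : set H) : Prop :=
  exists2 g : H, C = lcoset g Q &
    forall k, lcoset (eval_at g (E k)) Q = lcoset (eval_at u (E k)) Q.

End OneVariable.

(* Main.v *)
(** In a free group, if x and y do not commute and l is large, the value of
    x^6 (x^y)^l determines the pair (x, x^y) up to conjugation: a solution
    (x', x'^y') gives a cyclic word with a long run of x'^y', and since x' and
    x'^y' have the same translation length, that run must overlap the long run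
    of x^y for more than two periods; comparing lengths then identifies the
    two. Nesting such words gives, for every finite tuple c with two
    non-commuting entries, a word V such that V(d) = V(c) forces d to be
    conjugate to c.

    Let a system over H have a solution in G. Since A satisfies the law, the
    elements of I_A(H), the values E_k(u), and the same words evaluated anywhere
    in H lie in F. A test word V applied to finitely many of them turns one
    verbal equation into the prescription of all their values (up to
    conjugation), so by the uniqueness in (T3) it has a solution in H in which
    every coefficient is correct modulo Q; the left-hand sides w_k of the system
    are recovered modulo Q in the same way. This solves the system in H/Q.
    Finally, Q being divisible and Q /\ G' = 1 (again by verbal closedness),
    the identity of Q extends to rho : G -> Q, and multiplying the solution by
    suitable elements of Q corrects it. *)

Require Import Defs.
From mathcomp Require Import all_boot zify.
From mathcomp Require Import boolp classical_sets.
Set Implicit Arguments.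
Unset Strict Implicit.
Unset Printing Implicit Defensive.
Local Open Scope classical_set_scope.
Local Open Scope group_scope.

(** Nothing is known about G, so all rigidity takes place in F: a solution in G serves only to make
    a verbal equation solvable, and afterwards only its solution in H matters. The conjugation
    ambiguity of a test word is harmless, as one element of F moves all prescribed values and can be
    undone on the whole tuple. Nesting is harder: each inner word leaves its own conjugator, in the
    centralizer of its value. These conjugators are tied by equations s = x^K t r with s, t, r in
    three centralizers; for K large such an equation forces s = 1, because in the Cayley tree
    distinct axes soon separate. This is why powers Y^-K occur in the nested words.

    The exponent 6 comes from cancellation. Three periods on each side of a shortest double coset
    representative t protect the ends of c^3 t c^3, and the sixth power t^-1 c^6 t gives three
    periods to t^-1 and three to t.

    The image of Q need not be central in G; it becomes so modulo G', which is why the extension of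
    the identity of Q starts from Q G'. *)

Ltac grp := rewrite /conjg !gnorm //.

(** * Reduced words *)

Section CommonPrefix.
Variables (T : eqType) (x0 : T).
Implicit Types s t u : seq T.

Fixpoint lcp s t : nat :=
  match s, t with
  | x :: s', y :: t' => if x == y then (lcp s' t').+1 else 0
  | _, _ => 0
  end.

Lemma lcpC s t : lcp s t = lcp t s.
Proof. by elim: s t => [|x s IH] [|y t] //=; rewrite eq_sym IH. Qed.

Lemma lcp_sizel s t : lcp s t <= size s.
Proof. by elim: s t => [|x s IH] [|y t] //=; case: eqP => // _; apply: IH. Qed.

Lemma lcp_sizer s t : lcp s t <= size t.
Proof. by rewrite lcpC lcp_sizel. Qed.

Lemma lcp_nth s t i : i < lcp s t -> nth x0 s i = nth x0 t i.
Proof.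
elim: s t i => [|x s IH] [|y t] i //=; case: eqP => // -> .
by case: i => [|i] //= lti; apply: IH.
Qed.

Lemma leq_lcp s t k : k <= size s -> k <= size t ->
  (forall i, i < k -> nth x0 s i = nth x0 t i) -> k <= lcp s t.
Proof.
elim: k s t => [|k IH] [|x s] [|y t] //= ks kt E.
have /= -> := E 0 isT; rewrite eqxx ltnS; apply: IH => // i lti.
exact: (E i.+1).
Qed.

(** Applied to normal forms, this is the 0-hyperbolicity of the Cayley tree. *)
Lemma lcp_ultra s t u : minn (lcp s t) (lcp t u) <= lcp s u.
Proof.
apply: leq_lcp.
- by rewrite geq_min lcp_sizel.
- by rewrite geq_min lcp_sizer orbT.
by move=> i; rewrite leq_min => /andP[/lcp_nth-> /lcp_nth->].
Qed.

Lemma take_lcp s t : take (lcp s t) s = take (lcp s t) t.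
Proof. by elim: s t => [|x s IH] [|y t] //=; case: eqP => //= ->; rewrite IH. Qed.

End CommonPrefix.

Section ReducedWords.
Variables (X : choiceType) (x0 : X * bool).
Local Notation W := (word X).
Local Notation FX := (freeGroup X).
Local Notation wc := (@word_class X (fun _ => False)).
Implicit Types (u v w : W) (g h : FX) (l : X * bool).

Definition letter_inv l := (l.1, ~~ l.2).

Lemma letter_invK : involutive letter_inv.
Proof. by move=> [x b]; rewrite /letter_inv /= negbK. Qed.

Lemma letter_inv_neq l : letter_inv l != l.
Proof. by case: l => x b; rewrite /letter_inv /eq_op /= andbC; case: b. Qed.

Definition reduced w := sorted (fun a b => b != letter_inv a) w.

Lemma reducedP w :
  reflect (forall i, i.+1 < size w -> nth x0 w i.+1 != letter_inv (nth x0 w i))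
    (reduced w).
Proof. exact: sortedP. Qed.

(** Van der Waerden's method: letters act on reduced words by mutually inverse maps, so equal words
    act equally and [act w [::]] is a normal form. No confluence argument for free reduction is
    required. *)
Definition push l w := if w is l' :: w' then
  if l' == letter_inv l then w' else l :: w else [:: l].

Lemma push_reduced l w : reduced w -> reduced (push l w).
Proof.
case: w => //= l' w; case: eqVneq => [_ /path_sorted // | ne] /= P.
by rewrite /reduced /= ne.
Qed.

Lemma push_invK l w : reduced w -> push l (push (letter_inv l) w) = w.
Proof.
case: w => [|l' w] /=; first by rewrite eqxx.
rewrite letter_invK; case: eqVneq => [->|ne] /=; last by rewrite eqxx.
by case: w => [|l'' w] //= /andP[/negbTE->].
Qed.

Definition act u w := foldr push w u.

Lemma act_reduced u w : reduced w -> reduced (act u w).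
Proof. by elim: u => //= l u IH /IH; apply: push_reduced. Qed.

Lemma act_cat u v w : act (u ++ v) w = act u (act v w).
Proof. exact: foldr_cat. Qed.

Lemma word_eq_act u v : word_eq (fun _ : W => False) u v ->
  forall w, reduced w -> act u w = act v w.
Proof.
elim=> {u v} [//|u v _ IH w /IH//|u v w _ IH1 _ IH2 x rx||x b w rw|//].
- by rewrite IH1 // IH2.
- move=> u u' v v' _ IH1 _ IH2 w rw.
  by rewrite !act_cat IH2 // IH1 //; apply: act_reduced.
- exact: (@push_invK (x, b)).
Qed.

Lemma word_class_push l w : wc (push l w) = wc (l :: w).
Proof.
case: w => //= l' w; case: eqP => [->|//].
symmetry; apply/word_classP.
rewrite -[_ :: _]/([:: l; letter_inv l] ++ w) -[X in word_eq _ _ X]cat0s.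
apply: word_eq_cat; last exact: word_eq_refl.
by case: l => x b; apply: word_eq_cancel.
Qed.

Lemma word_class_act u w : wc (act u w) = wc (u ++ w).
Proof.
elim: u => //= l u IH; rewrite word_class_push.
by rewrite -cat1s word_class_cat IH -word_class_cat.
Qed.

Lemma act_reducedE w : reduced w -> act w [::] = w.
Proof.
elim: w => //= l w IH P; rewrite IH; last exact: path_sorted P.
by case: w P {IH} => //= l' w /andP[/negbTE->].
Qed.

Definition nf g : W := act (repr g) [::].
Definition len g := size (nf g).
(** The Gromov product of g and h based at 1 in the Cayley tree. *)
Definition cpl g h := lcp (nf g) (nf h).

Lemma nf_reduced g : reduced (nf g).
Proof. exact: act_reduced. Qed.

Lemma nfK g : wc (nf g) = g.
Proof. by rewrite /nf word_class_act cats0 /word_class reprK. Qed.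

Lemma nf_inj : injective nf.
Proof. exact: can_inj nfK. Qed.

Lemma nf_word_class w : nf (wc w) = act w [::].
Proof. by apply: word_eq_act => //; apply: repr_word_class. Qed.

Lemma nf_id w : reduced w -> nf (wc w) = w.
Proof. by move=> rw; rewrite nf_word_class act_reducedE. Qed.

Lemma size_inv_word w : size (inv_word w) = size w.
Proof. by rewrite size_rev size_map. Qed.

Lemma nth_inv_word w i : i < size w ->
  nth x0 (inv_word w) i = letter_inv (nth x0 w (size w - i.+1)).
Proof.
move=> lti; rewrite nth_rev size_map // (nth_map x0) //; lia.
Qed.

Lemma inv_word_reduced w : reduced w -> reduced (inv_word w).
Proof.
move=> /reducedP rw; apply/reducedP => i; rewrite size_inv_word => lti.
rewrite !nth_inv_word; [|lia..].
rewrite (inj_eq (can_inj letter_invK)) eq_sym.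
have -> : (size w - i.+1 = (size w - i.+2).+1)%N by lia.
have := rw (size w - i.+2) ltac:(lia).
by rewrite -(inj_eq (can_inj letter_invK)) letter_invK eq_sym.
Qed.

Lemma word_class_inv w : (wc w)^-1 = wc (inv_word w).
Proof.
apply: (@mulIg _ (wc w)); rewrite mulVg -word_class_cat.
by symmetry; apply/word_classP/word_eq_invl.
Qed.

Lemma nf_inv g : nf g^-1 = inv_word (nf g).
Proof. by rewrite -{1}[g]nfK word_class_inv nf_id ?inv_word_reduced ?nf_reduced. Qed.

Lemma len_inv g : len g^-1 = len g.
Proof. by rewrite /len nf_inv size_inv_word. Qed.

Lemma nf1 : nf 1 = [::].
Proof. exact: (@nf_id [::]). Qed.

Lemma len1 : len 1 = 0. Proof. by rewrite /len nf1. Qed.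

Lemma len_eq0 g : len g = 0 -> g = 1.
Proof. by move/size0nil => e; apply: nf_inj; rewrite e nf1. Qed.

Lemma cplC g h : cpl g h = cpl h g. Proof. exact: lcpC. Qed.
Lemma cpl_lenl g h : cpl g h <= len g. Proof. exact: lcp_sizel. Qed.
Lemma cpl_lenr g h : cpl g h <= len h. Proof. exact: lcp_sizer. Qed.
Lemma cpl_ultra g h k : minn (cpl g h) (cpl h k) <= cpl g k.
Proof. exact: (lcp_ultra x0). Qed.

Lemma reduced_cat u v : reduced u -> reduced v ->
  (0 < size u -> 0 < size v ->
   nth x0 v 0 != letter_inv (nth x0 u (size u).-1)) -> reduced (u ++ v).
Proof.
move=> /reducedP ru /reducedP rv J; apply/reducedP => i.
rewrite size_cat !nth_cat => lti.
case: (ltnP i.+1 (size u)) => [l1|]; first by rewrite (ltnW l1) ru.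
case: (ltnP i (size u)) => [l2 l3|l2 l3].
  have -> : (i.+1 - size u = 0)%N by lia.
  have -> : i = (size u).-1 by lia.
  apply: J; lia.
rewrite subSn //; apply: rv; lia.
Qed.

Lemma reduced_take k w : reduced w -> reduced (take k w).
Proof. exact: take_sorted. Qed.
Lemma reduced_drop k w : reduced w -> reduced (drop k w).
Proof. exact: drop_sorted. Qed.

Lemma nf_mul g h : nf (g * h) =
  take (len g - cpl g^-1 h) (nf g) ++ drop (cpl g^-1 h) (nf h).
Proof.
set k := cpl _ _.
have kg : k <= len g by rewrite -len_inv cpl_lenl.
have kh : k <= len h by rewrite cpl_lenr.
have E : drop (len g - k) (nf g) = inv_word (take k (nf h)).
  rewrite /k /cpl -take_lcp nf_inv -/(len g); move: (lcp _ _) => j.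
  by rewrite /inv_word take_rev map_rev revK -map_drop -map_comp size_map map_id_in // => -[x b] _ /=; rewrite negbK.
rewrite -{1}[g]nfK -{1}[h]nfK -[in LHS](cat_take_drop (len g - k) (nf g)).
rewrite -[in LHS](cat_take_drop k (nf h)) E !word_class_cat -word_class_inv.
rewrite mulgA mulgVK -word_class_cat nf_id //.
apply: reduced_cat; try exact/reduced_take/nf_reduced; try exact/reduced_drop/nf_reduced.
rewrite size_takel ?leq_subr // size_drop nth_drop addn0 => p1 p2.
(* One more cancelling letter would lengthen the common prefix of [g^-1] and h. *)
apply/eqP => e.
have : k < k; last by rewrite ltnn.
apply: (@leq_lcp _ x0); rewrite -/(len _) ?len_inv; try lia.
  by move: p2; rewrite -/(len h); lia.
move=> i; rewrite ltnS leq_eqVlt => /orP[/eqP->|]; last exact: lcp_nth.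
rewrite e nth_take ?nf_inv ?nth_inv_word -/(len g); [|lia..].
by congr (letter_inv (nth _ _ _)); lia.
Qed.

(** In the tripod with ends 1, g and g h, the two terms are the distances from 1 and from g to the
    branch point. *)
Lemma cpl_mul g h : cpl g (g * h) + cpl g^-1 h = len g.
Proof.
have kg : cpl g^-1 h <= len g by rewrite -len_inv cpl_lenl.
have kh : cpl g^-1 h <= len h by rewrite cpl_lenr.
apply/eqP; rewrite eqn_leq; apply/andP; split; last first.
  suff: len g - cpl g^-1 h <= cpl g (g * h) by lia.
  apply: (@leq_lcp _ x0); first by rewrite leq_subr.
    by rewrite nf_mul size_cat size_takel ?leq_subr // leq_addr.
  by move=> i lti; rewrite nf_mul nth_cat size_takel ?leq_subr // lti nth_take.
rewrite leqNgt; apply/negP => lt.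
set k := cpl g^-1 h in kg kh lt.
have lt2 : len g - k < cpl g (g * h) by lia.
have := lcp_nth x0 lt2; rewrite nf_mul nth_cat size_takel ?leq_subr // ltnn subnn.
rewrite nth_drop addn0 -/k => e.
have k0 : 0 < k by have := cpl_lenl g (g * h); lia.
have kh2 : k < len h.
  have := cpl_lenr g (g * h); rewrite /len nf_mul -/k size_cat size_takel ?leq_subr //.
  rewrite size_drop -/(len h); lia.
have e2 : nth x0 (nf h) k.-1 = letter_inv (nth x0 (nf g) (len g - k)).
  have lt3 : k.-1 < k by lia.
  rewrite -(lcp_nth x0 lt3) nf_inv nth_inv_word; last by rewrite -/(len g); lia.
  by congr (letter_inv (nth _ _ _)); rewrite -/(len g); lia.
have := (reducedP _ (nf_reduced h)) k.-1 ltac:(rewrite prednK //).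
by rewrite prednK // e2 letter_invK e eqxx.
Qed.

Lemma len_mul g h : len (g * h) + (cpl g^-1 h).*2 = (len g + len h)%N.
Proof.
have kg : cpl g^-1 h <= len g by rewrite -len_inv cpl_lenl.
have kh : cpl g^-1 h <= len h by rewrite cpl_lenr.
rewrite {1}/len nf_mul size_cat size_takel ?leq_subr // size_drop -/(len h); lia.
Qed.

Lemma len_mul_le g h : len (g * h) <= len g + len h.
Proof. by rewrite -len_mul leq_addr. Qed.

End ReducedWords.

(* [lia] cannot see that [a^-1 * b] elaborated through different canonical
   projections is the same group element; unify the atoms up to conversion. *)
Ltac glia :=
  repeat match goal with
  | H : is_true (leq _ _) |- _ => revert H
  | H : is_true (~~ _) |- _ => revert H
  | H : @eq nat _ _ |- _ => revert H
  end; clear;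
  repeat match goal with
  | |- context [cpl ?a ?b] =>
      repeat match goal with |- context [cpl ?c ?d] =>
        first [constr_eq (cpl a b) (cpl c d); fail 1 |
               unify (cpl a b) (cpl c d); change (cpl c d) with (cpl a b)] end;
      generalize (cpl a b)
  | |- context [len ?a] =>
      repeat match goal with |- context [len ?c] =>
        first [constr_eq a c; fail 1 |
               unify a c; change (len c) with (len a)] end;
      generalize (len a)
  end;
  repeat match goal with
  | |- context [@size ?T ?a] => generalize (@size T a)
  end; lia.

Lemma commute_conj (G : groupType) (x y g : G) :
  commute (x ^ g) (y ^ g) <-> commute x y.
Proof.
split; last by rewrite /commute -!conjMg => ->.
by rewrite /commute -!conjMg => /conjg_inj.
Qed.

(** * Periodic words *)

Section Periodic.
Variables (X : choiceType) (x0 : X * bool).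
Local Notation W := (word X).
Local Notation FX := (freeGroup X).
Local Notation wc := (@word_class X (fun _ => False)).
Implicit Types (u v w p q : W) (g h k : FX) (l : X * bool).

(** The point at distance S from 1 on the geodesic from 1 to g, or g itself if S is too large. *)
Definition vertex g S := wc (take S (nf g)).

Lemma vertex_cpl g h S : S <= cpl g h -> vertex g S = vertex h S.
Proof.
move=> le; have := congr1 (take S) (take_lcp (nf g) (nf h)).
by rewrite !take_takel // /vertex => ->.
Qed.

(** With k = [cpl g^-1 h], the geodesic to g h leaves that to g at distance len g - k and then
    follows the g-translate of the geodesic to h from its k-th vertex on. *)
Lemma vertex_mul g h S : len g <= S ->
  vertex (g * h) S = g * vertex h (S + (cpl g^-1 h).*2 - len g) /\
  nth x0 (nf (g * h)) S = nth x0 (nf h) (S + (cpl g^-1 h).*2 - len g).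
Proof.
set k := cpl _ _ => gS.
have kg : k <= len g by rewrite -(len_inv x0) cpl_lenl.
have kh : k <= len h by rewrite cpl_lenr.
rewrite /vertex (nf_mul x0) -/k; split; last first.
  rewrite nth_cat size_takel ?leq_subr // nth_drop ifN; last by lia.
  by congr nth; lia.
rewrite take_cat size_takel ?leq_subr // ifN; last by lia.
have -> : (S + k.*2 - len g = k + (S - (len g - k)))%N by lia.
rewrite takeD !word_class_cat mulgA; congr (_ * _).
apply: (canRL (mulgVK _)); rewrite -[RHS]nfK -[in RHS](cat_take_drop (len g - k) (nf g)).
rewrite word_class_cat; congr (_ * _).
rewrite word_class_inv /k /cpl -take_lcp (nf_inv x0) -/(len g); move: (lcp _ _) => j.
rewrite /inv_word take_rev map_rev revK.
by rewrite -map_drop -map_comp size_map map_id_in // => -[x b] _ /=; rewrite negbK.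
Qed.

Definition cred w := (0 < size w) && reduced (w ++ w).

(** [per w] is the infinite word w w w ..., [rt] gives its factors, and [pre] its prefixes as group
    elements. For w cyclically reduced the latter are the vertices of a ray on the axis of w. *)
Definition per w i := nth x0 w (i %% size w).
Definition rt w i n := mkseq (fun j => per w (i + j)) n.
Definition pre w i := wc (rt w 0 i).

Lemma rt_cat w i m n : rt w i (m + n) = rt w i m ++ rt w (i + m) n.
Proof.
rewrite /rt /mkseq iotaD map_cat add0n; congr (_ ++ _).
rewrite -[m in LHS]addn0 iotaDl -map_comp; apply: eq_map => j /=.
by rewrite addnA.
Qed.

Lemma rt_full w : rt w 0 (size w) = w.
Proof.
apply: (@eq_from_nth _ x0); rewrite size_mkseq // => i lti.
by rewrite nth_mkseq // /per add0n modn_small.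
Qed.

Lemma per_addl w i n : per w (n * size w + i) = per w i.
Proof. by rewrite /per modnMDl. Qed.

Lemma rt_addl w i n m : rt w (n * size w + i) m = rt w i m.
Proof. by apply: eq_mkseq => j; rewrite -addnA per_addl. Qed.

Lemma pre0 w : pre w 0 = 1. Proof. by []. Qed.

Lemma preD w i n : pre w (i + n) = pre w i * wc (rt w i n).
Proof. by rewrite /pre rt_cat word_class_cat add0n. Qed.

Lemma pre_addl w i n : pre w (n * size w + i) = wc w ^+ n * pre w i.
Proof.
elim: n => [|n IH]; first by rewrite mul0n add0n expg0 mul1g.
rewrite mulSn -addnA preD {1}/pre rt_full expgS -mulgA; congr (_ * _).
by rewrite -IH /pre -{1}[size w]addn0 -[X in rt w (X + 0)]mul1n rt_addl.
Qed.

Lemma pre_expg w n : pre w (n * size w) = wc w ^+ n.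
Proof. by rewrite -[(n * _)%N]addn0 pre_addl pre0 mulg1. Qed.

Lemma conj_pre w i : wc w ^ pre w i = wc (rt w i (size w)).
Proof.
rewrite conjgE; apply: (canLR (mulKg _)); rewrite -preD addnC -[size w]mul1n.
by rewrite pre_addl expg1.
Qed.

Lemma rt_nth w i m j : j < m -> nth x0 (rt w i m) j = per w (i + j).
Proof. exact: nth_mkseq. Qed.

Lemma size_rt w i m : size (rt w i m) = m. Proof. exact: size_mkseq. Qed.

Lemma rt_reduced w i m : cred w -> reduced (rt w i m).
Proof.
case/andP => s0 /(reducedP x0) r; apply/(reducedP x0) => j; rewrite size_rt => ltj.
rewrite !rt_nth //; last exact: ltnW.
have := r ((i + j) %% size w); rewrite size_cat !nth_cat ltn_mod s0 => /(_ _).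
have lt := ltn_pmod (i + j) s0; rewrite addnS.
have [e|ne] := eqVneq ((i + j) %% size w).+1 (size w).
  rewrite ifN; last by lia.
  have -> : (((i + j) %% size w).+1 - size w = 0)%N by lia.
  have -> : per w (i + j).+1 = nth x0 w 0.
    by rewrite /per -[(i + j).+1]addn1 -modnDml addn1 e modnn.
  by apply; lia.
rewrite ifT; last by lia.
have -> : per w (i + j).+1 = nth x0 w ((i + j) %% size w).+1.
  by rewrite /per -[(i + j).+1]addn1 -modnDml addn1 modn_small //; lia.
by apply; lia.
Qed.

Lemma nf_pre w n : cred w -> nf (pre w n) = rt w 0 n.
Proof. by move=> cw; rewrite nf_id // rt_reduced. Qed.

Lemma len_pre w n : cred w -> len (pre w n) = n.
Proof. by move=> cw; rewrite /len nf_pre // size_rt. Qed.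

Lemma len_expg w n : cred w -> len (wc w ^+ n) = (n * size w)%N.
Proof. by move=> cw; rewrite -pre_expg len_pre. Qed.

Lemma vertex_pre w n i : cred w -> i <= n -> vertex (pre w n) i = pre w i.
Proof.
move=> cw le; rewrite /vertex nf_pre // /pre; congr wc.
by rewrite -(subnKC le) rt_cat take_cat size_rt ltnn subnn take0 cats0.
Qed.

Lemma cred_size w : cred w -> 0 < size w. Proof. by case/andP. Qed.

(* The Fine-Wilf theorem. *)
Lemma overlap_commute p q g h A B : 0 < size p -> 0 < size q ->
  g * pre p A = h * pre q B ->
  (forall i, i < size p + size q -> per p (A + i) = per q (B + i)) ->
  commute (wc p ^ g^-1) (wc q ^ h^-1).
Proof.
move=> p0 q0 e E; rewrite -(commute_conj _ _ (g * pre p A)) {2}e !conjgM.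
rewrite !conjgKV !conj_pre /commute -!word_class_cat; congr wc.
apply: (@eq_from_nth _ x0); rewrite !size_cat !size_rt 1?addnC // => i lti.
rewrite !nth_cat !size_rt.
have Ep j : per p (A + (size p + j)) = per p (A + j).
  by rewrite addnCA -[X in X + _]mul1n per_addl.
have Eq j : per q (B + (size q + j)) = per q (B + j).
  by rewrite addnCA -[X in X + _]mul1n per_addl.
transitivity (per q (B + i)).
  case: (ltnP i (size p)) => ip; first by rewrite rt_nth // E //; lia.
  rewrite rt_nth; last by lia.
  rewrite -E; last by lia.
  by rewrite -Ep E; [congr per|]; lia.
case: ltnP => iq; first by rewrite rt_nth.
rewrite rt_nth; last by lia.
rewrite E; last by lia.
rewrite -[RHS]Eq; congr per; lia.
Qed.

Lemma overlap_eq p q g h A B : size p = size q ->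
  g * pre p A = h * pre q B ->
  (forall i, i < size p -> per p (A + i) = per q (B + i)) ->
  wc p ^ g^-1 = wc q ^ h^-1.
Proof.
move=> s e E; apply: (@conjg_inj _ (g * pre p A)); rewrite {2}e !conjgM !conjgKV !conj_pre.
by congr wc; apply: (@eq_from_nth _ x0); rewrite !size_rt // => i lti; rewrite !rt_nth -?s // E.
Qed.

(** Past distance len g + len h both geodesics read periodic words, translated by g and by h, so a
    longer common prefix is a common stretch of two axes. *)
Lemma overlap_cpl p q g h m n r : cred p -> cred q ->
  len g + len h + r <= cpl (g * wc p ^+ m) (h * wc q ^+ n) ->
  exists A B, g * pre p A = h * pre q B /\
    forall i, i < r -> per p (A + i) = per q (B + i).
Proof.
move=> cp cq; rewrite -!pre_expg.
move: (m * size p)%N (n * size q)%N => M N le.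
have := cpl_lenl (g * pre p M) (h * pre q N).
have := cpl_lenr (g * pre p M) (h * pre q N).
have := len_mul x0 g (pre p M); have := len_mul x0 h (pre q N).
rewrite !len_pre // => lmb lma lb la.
pose S := (len g + len h)%N.
have [va _] := @vertex_mul g (pre p M) S ltac:(rewrite leq_addr //).
have [vb _] := @vertex_mul h (pre q N) S ltac:(rewrite leq_addl //).
have vab : vertex (g * pre p M) S = vertex (h * pre q N) S.
  by apply: vertex_cpl; rewrite /S; lia.
exists (S + (cpl g^-1 (pre p M)).*2 - len g), (S + (cpl h^-1 (pre q N)).*2 - len h).
split.
  move: vab; rewrite va vb !vertex_pre //; rewrite /S; lia.
move=> i ir.
have lt : S + i < cpl (g * pre p M) (h * pre q N) by rewrite /S; lia.
have := lcp_nth x0 lt.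
have [_ ->] := @vertex_mul g (pre p M) (S + i) ltac:(rewrite -addnA leq_addr //).
have [_ ->] := @vertex_mul h (pre q N) (S + i) ltac:(rewrite addnAC leq_addl //).
rewrite !nf_pre // !rt_nth ?add0n //; [|rewrite /S in lt *; lia..].
by move=> e; apply: etrans (etrans e _); congr per; rewrite /S; lia.
Qed.

Lemma overlap_cpl_commute p q g h m n : cred p -> cred q ->
  len g + len h + (size p + size q) <= cpl (g * wc p ^+ m) (h * wc q ^+ n) ->
  commute (wc p ^ g^-1) (wc q ^ h^-1).
Proof.
move=> cp cq /overlap_cpl[] // A [B [e E]].
by apply: (@overlap_commute _ _ _ _ A B); rewrite ?cred_size.
Qed.

Lemma overlap_cpl_eq p q g h m n : cred p -> cred q -> size p = size q ->
  len g + len h + size p <= cpl (g * wc p ^+ m) (h * wc q ^+ n) ->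
  wc p ^ g^-1 = wc q ^ h^-1.
Proof.
move=> cp cq s /overlap_cpl[] // A [B [e E]].
exact: (@overlap_eq _ _ _ _ A B).
Qed.

Lemma conj_expg k g h n : k * g = h * k -> k * g ^+ n = h ^+ n * k.
Proof.
move=> e; elim: n => [|n IH]; first by rewrite !expg0 mulg1 mul1g.
by rewrite expgS mulgA e -mulgA IH !mulgA -expgS.
Qed.

(** Since k w1^M = w0^M k, the ray of w0 and the k-translate of the ray of w1 stay together as long
    as desired. *)
Lemma conj_cred_overlap w0 w1 k n : cred w0 -> cred w1 ->
  k * wc w1 = wc w0 * k ->
  exists A B, pre w0 A = k * pre w1 B /\
    forall i, i < n -> per w0 (A + i) = per w1 (B + i).
Proof.
move=> c0 c1 /(@conj_expg _ _ _ (n + (len k).*2 + 1)) e.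
(* One len k may be lost when k cancels on the right; the other is charged by [overlap_cpl]. *)
set M := (n + (len k).*2 + 1)%N in e.
have s0 := cred_size c0; have s1 := cred_size c1.
have [|A [B [eA EA]]] := @overlap_cpl w0 w1 1 k M M n c0 c1; last first.
  by exists A, B; rewrite -eA mul1g.
rewrite e mul1g len1 add0n.
have := cpl_mul x0 (wc w0 ^+ M) k; rewrite len_expg //.
have := cpl_lenr (wc w0 ^- M) k; have := leq_pmulr M s0.
have : n + (len k).*2 + 1 <= M by [].
clearbody M; set a := cpl _ _; set b := cpl _ _; move: (M * _)%N => c; lia.
Qed.

(** For M-th powers conjugation by k adds at most 2 len k to the length, which is less than M = 2
    len k + 1. *)
Lemma conj_cred_size w0 w1 k : cred w0 -> cred w1 ->
  k * wc w1 = wc w0 * k -> size w1 <= size w0.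
Proof.
move=> c0 c1 /(@conj_expg _ _ _ ((len k).*2 + 1)) e.
have h1 := len_mul_le x0 k^-1 (wc w0 ^+ ((len k).*2 + 1) * k).
have h2 := len_mul_le x0 (wc w0 ^+ ((len k).*2 + 1)) k.
move: h1 h2; rewrite -{1}e mulKg !len_expg // len_inv //.
move=> h1 h2; rewrite leqNgt; apply/negP => lt.
have := leq_mul (leqnn ((len k).*2 + 1)) lt; rewrite mulnS. move: h1 h2; clear.
move: (_ * size w1)%N (_ * size w0)%N; move: (len (_ * _)); move: (len k); lia.
Qed.

Lemma cred_nf g : g <> 1 -> cpl g^-1 g = 0 -> cred (nf g).
Proof.
move=> g1 c; apply/andP; split.
  by rewrite lt0n; apply/eqP => /len_eq0.
have := nf_mul x0 g g; rewrite c subn0 take_size drop0 => <-.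
exact: nf_reduced.
Qed.

(** If g is not cyclically reduced, its last letter is the inverse of its first letter a, and
    conjugation by a shortens g. *)
Lemma cyclically_reduce g : g <> 1 -> exists h c, cred c /\ g = wc c ^ h.
Proof.
have [n] := ubnP (len g); elim: n g => // n IH g; rewrite ltnS => le g1.
have [c|c] := posnP (cpl g^-1 g).
  by exists 1, (nf g); rewrite conjg1 nfK; split => //; apply: cred_nf.
case E: (nf g) => [|l w]; first by case: g1; apply: len_eq0; rewrite /len E.
have [a na] : exists a : FX, nf a = [:: l] by exists (wc [:: l]); rewrite nf_id.
have la : len a = 1%N by rewrite /len na.
have cag : cpl a g = 1%N by rewrite /cpl na E /= eqxx.
have ca : cpl a g^-1 = 1%N.
  rewrite /cpl in c; have := lcp_nth x0 c; rewrite E /cpl na /=.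
  by case: (nf g^-1) c => //= l' w' _ ->; rewrite eqxx; case: w'.
have g2 : 1 < len g.
  rewrite ltnNge; apply/negP => g2.
  have w0 : w = [::] by apply: size0nil; move: g2; rewrite /len E /=; case: (w).
  have ea : g = a by rewrite -[a]nfK -[g]nfK E na w0.
  move: ca; rewrite ea /cpl (nf_inv x0) na /=.
  by rewrite -/(letter_inv l) eq_sym (negbTE (letter_inv_neq l)).
have e1 := len_mul x0 a^-1 g; rewrite invgK cag (len_inv x0) la in e1.
have e2 : (len (a^-1 * g * a) + (cpl (g^-1 * a) a).*2 = len (a^-1 * g) + 1)%N.
  by rewrite -la -(len_mul x0 (a^-1 * g) a) invgM invgK.
have e3 := cpl_mul x0 g^-1 a; rewrite invgK [cpl g a]cplC cag (len_inv x0) in e3.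
have e4 := cpl_ultra x0 (g^-1 * a) g^-1 a; rewrite [cpl g^-1 a]cplC ca in e4.
rewrite [cpl (g^-1 * a) g^-1]cplC in e4.
have [||h [b [cb eb]]] := IH (a^-1 * g * a).
- by glia.
- by move=> e; apply: g1; apply: (@conjg_inj _ a); rewrite conj1g conjgE mulgA.
exists (h * a^-1), b; split => //; rewrite conjgM -eb; grp.
Qed.

End Periodic.

(** * Centralizers, roots and torsion in free groups *)

Section Centralizers.
Variables (X : choiceType) (x0 : X * bool).
Local Notation W := (word X).
Local Notation FX := (freeGroup X).
Local Notation wc := (@word_class X (fun _ => False)).
Implicit Types (c w : W) (g h k x y z : FX).

Definition in_cycle z y := exists n, y = z ^+ n \/ y = z ^- n.

Lemma in_cycle_commute z x y : in_cycle z x -> in_cycle z y -> commute x y.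
Proof.
have V (a b : FX) : commute a b -> commute a^-1 b.
  by move=> c; apply: commute_sym; apply: commuteV; apply: commute_sym.
case=> m ex [n ey]; have c := commuteX2 m n (commute_refl z).
by case: ex ey => -> [->|->]; [|exact: commuteV c|exact: V c|exact: V (commuteV c)].
Qed.

Lemma period_minimal c : 0 < size c -> exists d,
  (forall i, per x0 c (d + i) = per x0 c i) /\
  (forall s, (forall i, per x0 c (s + i) = per x0 c i) -> d %| s).
Proof.
move=> c0; pose P d := `[< 0 < d /\ forall i, per x0 c (d + i) = per x0 c i >].
have exP : exists d, P d.
  exists (size c); apply/asboolP; split => // i.
  by rewrite -[size c in LHS]mul1n per_addl.
case: (ex_minnP exP) => d /asboolP[d0 Pd] mind; exists d; split => // s Ps.
rewrite /dvdn; apply/eqP/eqP; rewrite -leqn0 leqNgt; apply/negP => r0.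
have Pm n i : per x0 c (n * d + i) = per x0 c i.
  by elim: n => // n IH; rewrite mulSn -addnA Pd.
have /mind : P (s %% d).
  apply/asboolP; split => // i.
  by rewrite -[LHS](Pm (s %/ d)) addnA -divn_eq.
by rewrite leqNgt ltn_mod d0.
Qed.

Lemma pre_period c d n i : (forall i, per x0 c (d + i) = per x0 c i) ->
  pre x0 c (n * d + i) = pre x0 c d ^+ n * pre x0 c i.
Proof.
move=> Pd; elim: n => [|n IH]; first by rewrite mul0n add0n expg0 mul1g.
rewrite mulSn -addnA preD expgS -mulgA -IH; congr (_ * _).
by congr wc; apply: eq_mkseq => j; rewrite add0n Pd.
Qed.

(** An element of the centralizer preserves the axis of c, so it shifts the periodic word by a
    period. All periods are multiples of the least one d, hence the element is a power of the prefix
    of length d. *)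
Lemma centralizer_cred c : cred c ->
  exists z, forall k, commute (wc c) k -> in_cycle z k.
Proof.
move=> cc; have c0 := cred_size cc.
have [d [Pd dvd]] := period_minimal c0; exists (pre x0 c d) => k ck.
have [A [B [e E]]] := conj_cred_overlap x0 (size c) cc cc (esym ck).
have {}E i : per x0 c (A + i) = per x0 c (B + i).
  rewrite (divn_eq i (size c)) addnCA per_addl [in RHS]addnCA per_addl.
  by rewrite E // ltn_mod.
have shift A' B' : B' <= A' -> (forall i, per x0 c (A' + i) = per x0 c (B' + i)) ->
    d %| A' - B'.
  move=> le E'; apply: dvd => i.
  rewrite -[LHS](per_addl x0 c _ B') -[RHS](per_addl x0 c _ B').
  have le2 : B' <= B' * size c by apply: leq_pmulr.
  have := E' (B' * size c + i - B'); rewrite [in RHS]subnKC ?(leq_trans le2) ?leq_addr // => <-.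
  by congr per; lia.
have [le|/ltnW le] := leqP B A.
  have /dvdnP[q eq] := shift _ _ le E; exists q; left.
  by apply: (@mulIg _ (pre x0 c B)); rewrite -e -pre_period // -eq subnK.
have /dvdnP[q eq] := shift _ _ le (fun i => esym (E i)); exists q; right.
apply: (@mulgI _ (pre x0 c d ^+ q)); rewrite mulgV.
apply: (@mulIg _ (pre x0 c B)); rewrite -mulgA -e -pre_period // -eq subnK //.
by rewrite mul1g.
Qed.

Lemma centralizer_cyclic x : x <> 1 ->
  exists z, commute x z /\ forall y, commute x y -> in_cycle z y.
Proof.
move=> x1; have [h [c [cc ex]]] := cyclically_reduce x0 x1.
have [z Cz] := centralizer_cred cc.
have Cx y : commute x y -> in_cycle (z ^ h) y.
  rewrite ex -[y](conjgKV h) commute_conj => /Cz[n e]; exists n.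
  by rewrite -!conjXg -conjVg; case: e => ->; [left|right].
exists (z ^ h); split => //.
by apply: (@in_cycle_commute (z ^ h)); [exact: Cx|exists 1%N; left].
Qed.

Lemma torsion_free x n : 0 < n -> x ^+ n = 1 -> x = 1.
Proof.
move=> n0 e; apply: contrapT => x1.
have [h [c [cc ex]]] := cyclically_reduce x0 x1.
have := len_expg x0 n cc; have c0 := cred_size cc.
have -> : wc c ^+ n = 1.
  by apply: (@conjg_inj _ h); rewrite conjXg -ex e conj1g.
rewrite len1 => /esym/eqP; rewrite muln_eq0 -leqn0 leqNgt n0 -leqn0 leqNgt c0 //.
Qed.

Lemma commute_trans y a b : y <> 1 -> commute y a -> commute y b -> commute a b.
Proof.
move=> /centralizer_cyclic[z [_ Cz]] /Cz ca /Cz cb; exact: in_cycle_commute ca cb.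
Qed.

Lemma expg_commute x y n : 0 < n -> commute (x ^+ n) y -> commute x y.
Proof.
move=> n0 c; have [->|x1] := pselect (x = 1); first exact/commute_sym/commute1.
apply: commute_trans c; last exact/commute_sym/commuteX.
by move=> /(torsion_free n0).
Qed.

Lemma expg_inj x y n : 0 < n -> x ^+ n = y ^+ n -> x = y.
Proof.
move=> n0 e; have cxy : commute x y.
  by apply: (expg_commute n0); rewrite e; apply/commute_sym/commuteX.
apply: divg1_eq; apply: (torsion_free n0).
by rewrite expgnFl // e mulgV.
Qed.

Lemma conjg_id_commute x y : x ^ y = x <-> commute x y.
Proof. by split=> [/conjg_fixP/commgP//|?]; apply/conjg_fixP/commgP. Qed.

(** The square of y commutes with x, hence y does, so x equals its inverse and torsion-freeness
    applies. *)
Lemma conj_inv_eq1 x y : x ^ y = x^-1 -> x = 1.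
Proof.
move=> e; apply: (@torsion_free _ 2) => //.
have c : commute x y.
  have [y1|y1] := pselect (y ^+ 2 = 1).
    by rewrite (torsion_free _ y1) //; apply: commute1.
  have c2 : commute x (y ^+ 2).
    by apply/conjg_id_commute; rewrite expg2 conjgM e conjVg e invgK.
  by apply: (commute_trans y1); [apply: commute_sym|apply/commute_sym/commuteX].
move/conjg_id_commute: c; rewrite e => c.
by rewrite expg2 -{1}c mulVg.
Qed.

Lemma expg_self z n : z <> 1 -> z = z ^+ n -> n = 1%N.
Proof.
move=> z1; case: n => [//|[//|n]]; rewrite expgS -{1}[z]mulg1 => /mulgI/esym.
by move/torsion_free => /(_ isT).
Qed.

Lemma expgV_self z n : z <> 1 -> z <> z ^- n.
Proof.
move=> z1 e; apply: z1; apply: (@torsion_free _ n.+1) => //.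
by rewrite expgS {1}e mulVg.
Qed.

(** Conjugation by y preserves the cyclic centralizer common to x and [x ^ y]. It therefore maps a
    generator z to z or to its inverse, and [conj_inv_eq1] excludes the inverse. *)
Lemma commute_conj_self x y : commute x (x ^ y) -> commute x y.
Proof.
move=> c; have [->|x1] := pselect (x = 1); first exact/commute_sym/commute1.
have [z [xz Cz]] := centralizer_cyclic x1.
have z1 : z <> 1 by move=> e; case: (Cz x (commute_refl x)) => n; rewrite e expg1n invg1 => -[].
have xy1 : x ^ y <> 1 by move=> /(congr1 (conjg^~ y^-1)); rewrite conjgK conj1g.
have [n en] : in_cycle z (z ^ y^-1).
  apply: Cz; apply/(commute_conj _ _ y); rewrite conjgKV.
  exact: commute_trans c xz.
have [m em] : in_cycle z (z ^ y).
  by apply: Cz; apply: (commute_trans xy1); [apply: commute_sym|apply/commute_conj].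
have ez : z = (z ^ y^-1) ^ y by rewrite conjgKV.
have mn1 : (m * n)%N = 1%N -> commute x y.
  move=> /eqP; rewrite muln_eq1 => /andP[/eqP m1 /eqP _].
  move: em; rewrite m1 expg1 => -[/conjg_id_commute|/conj_inv_eq1 //].
  by move=> zy; apply: commute_trans zy => //; apply: commute_sym.
case: en => en; rewrite {}en ?conjVg conjXg in ez; case: em => em;
  rewrite em ?expVgn ?invgK -expgnA in ez.
- exact/mn1/(expg_self z1).
- by case: (expgV_self z1 ez).
- by case: (expgV_self z1 ez).
- exact/mn1/(expg_self z1).
Qed.

Lemma expg_conj_commute x y n : 0 < n -> commute x ((x ^ y) ^+ n) -> commute x y.
Proof. by move=> n0 /commute_sym/(expg_commute n0)/commute_sym/commute_conj_self. Qed.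

End Centralizers.

(** * Cyclically reduced words for products with a long power *)

Section Literal.
Variables (X : choiceType) (x0 : X * bool).
Local Notation W := (word X).
Local Notation FX := (freeGroup X).
Local Notation wc := (@word_class X (fun _ => False)).
Local Notation per := (per x0).
Local Notation pre := (pre x0).
Local Notation rt := (rt x0).
Implicit Types (c w u v : W) (g h k s t x y z : FX).

Lemma in_cycleM z x y : in_cycle z x -> in_cycle z y -> in_cycle z (x * y).
Proof.
have FB m n : in_cycle z (z ^+ m * z ^- n).
  case: (leqP n m) => le; first by exists (m - n); left; rewrite expgnFr.
  by exists (n - m); right; rewrite expgnFr 1?ltnW // invgM invgK.
case=> m [->|->] [n [->|->]].
- by exists (m + n); left; rewrite expgnDr.
- exact: FB.
- rewrite -(commuteV (commuteX2 n m (commute_refl z))); exact: FB.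
- by exists (n + m); right; rewrite expgnDr invgM.
Qed.

Lemma cred_inv c : cred c -> cred (inv_word c).
Proof.
case/andP => s r; rewrite /cred size_inv_word s.
by have := inv_word_reduced x0 r; rewrite /inv_word map_cat rev_cat.
Qed.

Lemma cred_neq1 c : cred c -> wc c <> 1.
Proof.
move=> cc e; have := len_expg x0 1 cc; rewrite e expg1 len1 mul1n.
by have := cred_size cc; case: (size c).
Qed.

Lemma cpl_pre c m n : cred c -> minn m n <= cpl (pre c m) (pre c n).
Proof.
move=> cc; rewrite /cpl !nf_pre //; apply: (@leq_lcp _ x0).
- by rewrite size_rt geq_minl.
- by rewrite size_rt geq_minr.
by move=> i; rewrite leq_min => /andP[? ?]; rewrite !rt_nth.
Qed.

Lemma cpl_cred_expg c t n : cred c -> cpl t (wc c) < size c ->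
  cpl t (wc c ^+ n) < size c.
Proof.
move=> cc lt; have c0 := cred_size cc; case: n => [|n].
  by have := cpl_lenr t (wc c ^+ 0); rewrite expg0 len1; lia.
have := cpl_pre (n.+1 * size c) (1 * size c) cc; rewrite !pre_expg expg1 => h1.
rewrite ltnNge; apply/negP => h2.
have := cpl_ultra x0 t (wc c ^+ n.+1) (wc c).
have : size c <= n.+1 * size c by rewrite leq_pmull.
rewrite mul1n in h1; move: h1 h2 lt; clear.
move: (n.+1 * _)%N => a; glia.
Qed.

(** Multiplying t by c or its inverse, on either side, cancels less than a whole copy of c. *)
Definition normalized c t := [/\ cpl t (wc c) < size c,
  cpl t (wc c)^-1 < size c, cpl t^-1 (wc c) < size c & cpl t^-1 (wc c)^-1 < size c].

Lemma len_cred c : cred c -> len (wc c) = size c.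
Proof. by move=> cc; have := len_expg x0 1 cc; rewrite expg1 mul1n. Qed.

(* t is a shortest element of the double coset <c> s <c>. *)
Lemma normalize c s : cred c -> exists t a b,
  [/\ normalized c t, in_cycle (wc c) a, in_cycle (wc c) b & s = a * t * b].
Proof.
move=> cc; have c0 := cred_size cc; have lc := len_cred cc.
have in1 : in_cycle (wc c) 1 by exists 0; left.
have inc : in_cycle (wc c) (wc c) by exists 1%N; left.
have inV : in_cycle (wc c) (wc c)^-1 by exists 1%N; right.
have [n] := ubnP (len s); elim: n s => // n IH s; rewrite ltnS => le.
have lV : len (wc c)^-1 = size c by rewrite (len_inv x0).
case: (ltnP (cpl s (wc c)) (size c)) => h1; last first.
  have e1 : (len ((wc c)^-1 * s) + (cpl s (wc c)).*2 = len (wc c)^-1 + len s)%N.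
    by rewrite -(len_mul x0) invgK cplC.
  have [|t [a [b [nt ia ib e]]]] := IH ((wc c)^-1 * s); first by rewrite lV in e1; glia.
  by exists t, (wc c * a), b; split => //; [apply: in_cycleM|rewrite -!mulgA !(mulgA a) -e mulVKg].
case: (ltnP (cpl s (wc c)^-1) (size c)) => h2; last first.
  have e1 := len_mul x0 (wc c) s; rewrite cplC lc in e1.
  have [|t [a [b [nt ia ib e]]]] := IH (wc c * s); first by glia.
  by exists t, ((wc c)^-1 * a), b; split => //; [apply: in_cycleM|rewrite -!mulgA !(mulgA a) -e mulKg].
case: (ltnP (cpl s^-1 (wc c)) (size c)) => h3; last first.
  have e1 := len_mul x0 s (wc c); rewrite lc in e1.
  have [|t [a [b [nt ia ib e]]]] := IH (s * wc c); first by glia.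
  by exists t, a, (b * (wc c)^-1); split => //; [apply: in_cycleM|rewrite mulgA -e mulgK].
case: (ltnP (cpl s^-1 (wc c)^-1) (size c)) => h4; last first.
  have e1 := len_mul x0 s (wc c)^-1; rewrite lV in e1.
  have [|t [a [b [nt ia ib e]]]] := IH (s * (wc c)^-1); first by glia.
  by exists t, a, (b * wc c); split => //; [apply: in_cycleM|rewrite mulgA -e mulgVK].
by exists s, 1, 1; rewrite mul1g mulg1.
Qed.

Lemma normalizedV c t : normalized c t -> normalized c t^-1.
Proof. by case=> *; split=> //; rewrite invgK. Qed.

Lemma normalized_inv c t : normalized c t -> normalized (inv_word c) t.
Proof.
by case=> *; rewrite /normalized size_inv_word -word_class_inv invgK.
Qed.

(* Further cancellation would give c ^ t^-1 = c^-1, which is impossible in a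
   free group. *)
Lemma normalized_cancel c t : cred c -> normalized c t ->
  cpl (wc c ^- 3) (t * wc c ^+ 3) < 3 * size c.
Proof.
move=> cc [h1 h2 h3 h4]; have c0 := cred_size cc.
have cc' := cred_inv cc; have wc' := word_class_inv c.
have s' := size_inv_word c.
rewrite ltnNge; apply/negP => le.
have k1 : cpl t (wc c ^- 3) < size c.
  by rewrite -expVgn wc' -s'; apply: cpl_cred_expg; rewrite // -wc' s'.
have k2 : cpl t^-1 (wc c ^+ 3) < size c by apply: cpl_cred_expg.
(* Origin of the 3: this inequality gives len t < 2 size c, and [overlap_cpl_eq] asks for len t plus
   one more period. *)
have u := cpl_ultra x0 t (t * wc c ^+ 3) (wc c ^- 3).
rewrite [cpl (t * _) _]cplC in u.
have e := cpl_mul x0 t (wc c ^+ 3).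
suff E : wc c ^ t^-1 = (wc c)^-1 by case: (cred_neq1 cc (conj_inv_eq1 x0 E)).
have <- : wc (inv_word c) ^ 1^-1 = (wc c)^-1 by rewrite invg1 conjg1 wc'.
apply: (@overlap_cpl_eq _ x0 c (inv_word c) t 1 3 3) => //.
by rewrite len1 mul1g -wc' expVgn cplC; glia.
Qed.

(** Such words can be concatenated with each other and with copies of c without cancellation. *)
Definition fits c w := [/\ 0 < size w, reduced w,
  nth x0 w 0 = nth x0 c 0 & nth x0 w (size w).-1 = nth x0 c (size c).-1].

Lemma cred_junction c : cred c -> nth x0 c 0 != letter_inv (nth x0 c (size c).-1).
Proof.
case/andP => s0 /(reducedP x0) /(_ (size c).-1); rewrite size_cat !nth_cat prednK //.
rewrite ltnn subnn leqnn; apply; lia.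
Qed.

Lemma fits_id c : cred c -> fits c c.
Proof. case/andP => s0 r; split=> //; by have := reduced_take (size c) r; rewrite take_size_cat. Qed.

Lemma fits_cat c u v : cred c -> fits c u -> fits c v -> fits c (u ++ v).
Proof.
move=> cc [su ru hu lu] [sv rv hv lv]; split.
- by rewrite size_cat; lia.
- by apply: (reduced_cat (x0 := x0)) => // _ _; rewrite hv lu cred_junction.
- by rewrite nth_cat su.
- rewrite size_cat nth_cat ifN; last by lia.
  by rewrite -lv; congr nth; lia.
Qed.

Lemma fits_cred c u : cred c -> fits c u -> cred u.
Proof. by move=> cc fu; have [s0 _ _ _] := fu; have [_ r _ _] := fits_cat cc fu fu; rewrite /cred s0. Qed.

Lemma fits_power c n u : cred c -> fits c u -> fits c (rt c 0 (n * size c) ++ u).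
Proof.
move=> cc fu; case: n => [//|n]; apply: fits_cat => //; have c0 := cred_size cc.
have s0 : 0 < n.+1 * size c by rewrite muln_gt0 c0.
split; rewrite ?size_rt ?rt_reduced // rt_nth //; last by rewrite prednK.
  by rewrite /per addn0 mod0n.
rewrite /per add0n; have -> : (n.+1 * size c).-1 = (n * size c + (size c).-1)%N.
  by rewrite mulSn; lia.
by rewrite modnMDl modn_small // ltn_predL.
Qed.

(** Cancellation stops before it exhausts the left c^3, so the first letter survives. The last
    letter is handled through the inverse element. *)
Lemma normalized_fits c t : cred c -> normalized c t ->
  fits c (nf (wc c ^+ 3 * t * wc c ^+ 3)).
Proof.
move=> cc nt; have c0 := cred_size cc.
have head c' t' : cred c' -> normalized c' t' ->
    0 < cpl (wc c' ^+ 3) (wc c' ^+ 3 * t' * wc c' ^+ 3).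
  move=> cc' nt'; have lt := normalized_cancel cc' nt'.
  have := cpl_mul x0 (wc c' ^+ 3) (t' * wc c' ^+ 3).
  rewrite len_expg // mulgA; glia.
have h1 := head _ _ cc nt.
have h2 := head _ _ (cred_inv cc) (normalized_inv (normalizedV nt)).
set g := _ * t * _ in h1 *.
have eg : wc (inv_word c) ^+ 3 * t^-1 * wc (inv_word c) ^+ 3 = g^-1.
  by rewrite -word_class_inv expVgn /g !invgM [RHS]mulgA.
rewrite {}eg in h2.
have g0 : 0 < size (nf g) by apply: leq_trans h1 (cpl_lenr _ _).
have nfc d n : cred d -> 0 < n -> nth x0 (nf (wc d ^+ n)) 0 = nth x0 d 0.
  move=> cd n0; have d0 := cred_size cd.
  by rewrite -(pre_expg x0) nf_pre // rt_nth ?muln_gt0 ?n0 // /per addn0 mod0n.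
split; rewrite ?nf_reduced //.
  by rewrite -(lcp_nth x0 h1) nfc.
have := lcp_nth x0 h2; rewrite nfc ?cred_inv // (nf_inv x0) !nth_inv_word // !subn1.
by move/(can_inj (@letter_invK X)).
Qed.

Lemma expg_commute_in_cycle z a n : in_cycle z a -> commute (z ^+ n) a.
Proof. by move=> ia; apply: in_cycle_commute ia; exists n; left. Qed.

(** Conjugating z to c and s to a t b with a, b in <c>, the product becomes conjugate to t (b c^l a)
    = t c^(L + 6). Three periods on each side of t go into v, the remaining L form the run, and e
    absorbs the power b a and these six periods. *)
Lemma one_run_form s z : z <> 1 -> exists c v e, [/\ cred c, fits c v &
  forall l, e <= l -> exists L k, [/\ l <= L + e, L <= l + e,
    s * z ^+ l = wc (rt c 0 (L * size c) ++ v) ^ k & z = wc c ^ k]].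
Proof.
move=> z1; have [h [c [cc ez]]] := cyclically_reduce x0 z1.
have [t [a [b [nt ia ib es]]]] := normalize (s ^ h^-1) cc.
have [q eq] := in_cycleM ib ia.
exists c, (nf (wc c ^+ 3 * t * wc c ^+ 3)), (q + 6)%N; split => //.
  exact: normalized_fits.
move=> l le.
have [L [l1 l2 eL]] : exists L, [/\ l <= L + (q + 6), L <= l + (q + 6) &
    b * wc c ^+ l * a = wc c ^+ (L + 6)].
  have e0 : b * wc c ^+ l * a = b * a * wc c ^+ l.
    by rewrite -!mulgA (expg_commute_in_cycle l ia).
  case: eq => eq; rewrite e0 eq.
    exists (q + l - 6)%N; split; [lia|lia|].
    by rewrite -expgnDr; congr (_ ^+ _); lia.
  exists (l - q - 6)%N; split; [lia|lia|].
  by apply: (canLR (mulKg _)); rewrite -expgnDr; congr (_ ^+ _); lia.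
exists L, (wc c ^+ (L + 3) * a^-1 * h); split=> //; last first.
  rewrite ez !conjgM; congr (_ ^ h).
  have /conjg_id_commute -> : commute (wc c) (wc c ^+ (L + 3)) by apply: commuteX.
  symmetry; apply/conjg_id_commute/commuteV.
  by have := expg_commute_in_cycle 1 ia; rewrite expg1.
rewrite -[s](conjgKV h) es ez -conjXg -conjMg !conjgM; congr (_ ^ h).
rewrite word_class_cat nfK -/(pre c _) pre_expg.
have -> : a * t * b * wc c ^+ l = (t * (b * wc c ^+ l * a)) ^ a^-1 by grp.
congr (_ ^ a^-1); rewrite eL conjgE.
apply: (canRL (mulKg _)).
have -> : wc c ^+ (L + 6) = wc c ^+ 3 * wc c ^+ (L + 3).
  by rewrite -expgnDr; congr (_ ^+ _); lia.
rewrite {1}(expgnDr _ L 3).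
move: (wc c ^+ L) (wc c ^+ 3) (wc c ^+ (L + 3)) => p q' r.
by rewrite !mulgA.
Qed.

(** Up to conjugacy this is t^-1 c^6 t c^l; halving c^6 and taking three periods from each end of
    c^l gives the two blocks of v. The bound on l and the run length l - 6 are independent of z and
    y, which is essential because the lemma is applied to an unknown solution. *)
Lemma two_run_form z y : z <> 1 -> exists c v, [/\ cred c, fits c v &
  forall l, 6 <= l -> exists k,
    (z ^ y) ^+ 6 * z ^+ l = wc (rt c 0 ((l - 6) * size c) ++ v) ^ k /\ z = wc c ^ k].
Proof.
move=> z1; have [h [c [cc ez]]] := cyclically_reduce x0 z1.
have [t [a [b [nt ia ib es]]]] := normalize (h * y * h^-1) cc.
exists c, (nf (wc c ^+ 3 * t^-1 * wc c ^+ 3) ++ nf (wc c ^+ 3 * t * wc c ^+ 3)).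
split=> //; first by apply: fits_cat => //; apply: normalized_fits => //; apply: normalizedV.
move=> l le; exists (wc c ^+ (l - 3) * b * h).
have ba : wc c ^ a = wc c.
  by apply/conjg_id_commute; have := expg_commute_in_cycle 1 ia; rewrite expg1.
have bb : wc c ^ b = wc c.
  by apply/conjg_id_commute; have := expg_commute_in_cycle 1 ib; rewrite expg1.
have bl : wc c ^ (wc c ^+ (l - 3)) = wc c by apply/conjg_id_commute/commuteX.
split; last by rewrite !conjgM bl bb.
have ezy : z ^ y = ((wc c ^ t) ^ b) ^ h.
  have -> : y = (a * t * b) ^ h by rewrite -es; grp.
  by rewrite ez -conjJg !conjgM ba.
rewrite ezy {}ez -!conjXg -conjMg !conjgM; congr (_ ^ h).
rewrite -[in wc c ^+ l]bb -conjXg -conjMg; congr (_ ^ b).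
rewrite !word_class_cat !nfK -/(pre c _) pre_expg conjXg conjgE.
apply: (canRL (mulKg _)).
have -> : wc c ^+ (l - 3) = wc c ^+ (l - 6) * wc c ^+ 3 by rewrite -expgnDr; congr (_ ^+ _); lia.
have -> : wc c ^+ l = wc c ^+ 3 * (wc c ^+ (l - 6) * wc c ^+ 3).
  by rewrite -!expgnDr; congr (_ ^+ _); lia.
rewrite -conjXg conjgE (expgnDr _ 3 3).
move: (wc c ^+ (l - 6)) (wc c ^+ 3) => p r; grp.
Qed.

End Literal.

(** * Rigidity of x ^ 6 * (x ^ y) ^ l *)

Section PairRigidity.
Variables (X : choiceType) (x0 : X * bool).
Local Notation W := (word X).
Local Notation FX := (freeGroup X).
Local Notation wc := (@word_class X (fun _ => False)).
Local Notation per := (per x0).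
Local Notation pre := (pre x0).
Local Notation rt := (rt x0).
Implicit Types (c w u v : W) (g h k s t x y z : FX).

Lemma per_run c v L i : i < L * size c -> per (rt c 0 (L * size c) ++ v) i = per c i.
Proof.
move=> lt; rewrite {1}/per modn_small; last by rewrite size_cat size_rt ltn_addr.
by rewrite nth_cat size_rt lt rt_nth.
Qed.

Lemma pre_run c v L i : i <= L * size c ->
  pre (rt c 0 (L * size c) ++ v) i = pre c i.
Proof.
move=> le; congr wc; apply: (@eq_from_nth _ x0); rewrite !size_rt // => j lt.
by rewrite !rt_nth // per_run // (leq_trans lt).
Qed.

Lemma size_run c v L : size (rt c 0 (L * size c) ++ v) = (L * size c + size v)%N.
Proof. by rewrite size_cat size_rt. Qed.

(* Some window of the run of b lies inside a run of c, where Fine-Wilf applies. *)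
Lemma run_overlap c b v u L M k : cred c -> cred b ->
  let w0 := rt c 0 (L * size c) ++ v in
  let w1 := rt b 0 (M * size b) ++ u in
  cred w0 -> cred w1 -> k * wc w1 = wc w0 * k ->
  size b <= size c -> 2 <= L -> size v + 4 * size c <= M ->
  exists i j, commute (wc c ^ (wc w0 ^- i)) ((wc b ^ k^-1) ^ (wc w0 ^- j)).
Proof.
move=> cc cb w0 w1 cw0 cw1 ek bc L2 LM.
have c0 := cred_size cc; have b0 := cred_size cb.
have n0 := cred_size cw0; have n1 := cred_size cw1.
have [A [B [eAB EAB]]] := conj_cred_overlap x0 (size w0 * size w1) cw0 cw1 ek.
(* The overlap covers a common period of both words, so they agree forever. *)
have {}EAB i : per w0 (A + i) = per w1 (B + i).
  rewrite (divn_eq i (size w0 * size w1)) mulnA addnCA.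
  rewrite [X in per w0 (X + _)]mulnAC per_addl [in RHS]addnCA per_addl EAB //.
  by rewrite ltn_mod muln_gt0 n0.
have le1 : B <= B * size w1 by apply: leq_pmulr.
pose i1 := (B * size w1 - B)%N.
have eP : pre w0 (A + i1) = k * wc w1 ^+ B.
  rewrite -(pre_expg x0) -[(B * size w1)%N](subnKC le1) !preD mulgA -eAB; congr (_ * wc _).
  by apply: eq_mkseq => i; rewrite EAB.
have EP i : per w0 ((A + i1) %% size w0 + i) = per w1 i.
  rewrite -[RHS](per_addl x0 _ _ B) -(subnKC le1) -addnA -/i1 -EAB.
  have -> : (A + (i1 + i) = (A + i1) %/ size w0 * size w0 + ((A + i1) %% size w0 + i))%N.
    by rewrite !addnA -divn_eq.
  by rewrite per_addl.
rewrite (divn_eq (A + i1) (size w0)) pre_addl in eP.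
move: ((A + i1) %/ size w0) ((A + i1) %% size w0) (ltn_pmod (A + i1) n0) EP eP => j0 r ltr EP eP.
have sw0 : size w0 = (L * size c + size v)%N by apply: size_run.
have cM : M <= M * size b by apply: leq_pmulr.
have L2c : 2 * size c <= L * size c by rewrite leq_mul2r L2 orbT.
have fin j : commute (wc c ^ (wc w0 ^+ j)^-1) (wc b ^ (k * wc w1 ^+ B)^-1) ->
    exists i j, commute (wc c ^ (wc w0 ^- i)) ((wc b ^ k^-1) ^ (wc w0 ^- j)).
  move=> cm; exists j, B; move: cm.
  by rewrite (conj_expg _ ek) invgM conjgM.
(* A run of b starts at position r of w0. If two periods of c remain there, compare at once;
   otherwise compare at the start of the next copy of w0, less than size v + 2 size c letters
   further, where the run of b still has two periods of c to go. *)
case: (leqP (r + 2 * size c) (L * size c)) => h.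
  apply: (fin j0); apply: (@overlap_commute _ x0 c b _ _ r 0) => //.
    by rewrite -[pre c r](@pre_run c v L) 1?eP ?pre0 ?mulg1 //; lia.
  move=> i lt; rewrite -(@per_run c v L) ?EP ?per_run //; [|lia..].
  lia.
have le2 : size w0 - r <= M * size b by lia.
apply: (fin j0.+1); apply: (@overlap_commute _ x0 c b _ _ 0 (size w0 - r)) => //.
  rewrite pre0 mulg1 -[pre b _](@pre_run b u M) //.
  have e1 : pre w0 (r + (size w0 - r)) = pre w0 r * pre w1 (size w0 - r).
    rewrite preD; congr (_ * wc _); apply: eq_mkseq => i.
    by rewrite add0n EP.
  rewrite subnKC ?(ltnW ltr) // -[size w0 in LHS]mul1n (pre_expg x0) expg1 in e1.
  by rewrite expgSr {2}e1 mulgA eP.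
move=> i lt; rewrite add0n -(@per_run c v L); last by lia.
rewrite -(@per_run b u M); last by lia.
by rewrite -/w1 -EP addnA subnKC ?(ltnW ltr) // -[size w0 in RHS]mul1n per_addl.
Qed.

Lemma conj_run_bound c z x y n w : cred c -> cred w -> wc c ^ x = z -> wc w ^ y = z ^+ n ->
  0 < n -> size w <= n * size c.
Proof.
move=> cc cw <-; rewrite -conjXg => e n0.
have c0 := cred_size cc.
have cn : cred (rt c 0 (n.-1 * size c) ++ c) by apply: (fits_cred (x0 := x0) cc); apply: fits_power => //; apply: fits_id.
have ew : wc (rt c 0 (n.-1 * size c) ++ c) = wc c ^+ n.
  by rewrite word_class_cat -/(pre c _) pre_expg -expgSr prednK.
have -> : (n * size c = size (rt c 0 (n.-1 * size c) ++ c))%N.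
  by rewrite size_run -mulSnr prednK.
apply: (@conj_cred_size _ x0 _ _ (x * y^-1)) => //.
apply: (@conjg_inj _ y); rewrite ew !conjMg e !conjgE; grp.
Qed.

Lemma pair_rigidity x y : ~ commute x y -> exists2 l, 0 < l & forall x' y',
  x' ^+ 6 * (x' ^ y') ^+ l = x ^+ 6 * (x ^ y) ^+ l ->
  exists g, x' = x ^ g /\ x' ^ y' = (x ^ y) ^ g.
Proof.
move=> nc; set z := x ^ y.
have x1 : x <> 1 by move=> e; apply: nc; rewrite e; apply/commute_sym/commute1.
have z1 : z <> 1 by move=> /eqP; rewrite conjg_eq1 => /eqP.
have [r [zr Cr]] := centralizer_cyclic x0 z1.
have r1 : r <> 1 by move=> e; case: (Cr z (commute_refl z)) => n; rewrite e expg1n invg1 => -[].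
have rV1 : r^-1 <> 1 by move=> /eqP; rewrite invg_eq1 => /eqP.
have [c [v [e [cc fv form]]]] := one_run_form x0 (x ^+ 6) z1.
(* The forms for r and its inverse serve the last case, where a power of r of unknown sign
   appears. *)
have [c1 [v1 [e1 [cc1 fv1 form1]]]] := one_run_form x0 (x ^+ 6) r1.
have [c2 [v2 [e2 [cc2 fv2 form2]]]] := one_run_form x0 (x ^+ 6) rV1.
(* A generous sum of all thresholds: for comparing the periods b and c, for the overlap of runs, and
   for the final length contradiction, with the defects e, e1, e2 of the three forms. *)
pose l := ((e + 6) * size c + size v + 10 * size c + e + e1 + e2 + 20)%N.
exists l; first by rewrite /l addnS.
move=> x' y' eW; set z' := x' ^ y' in eW *.
have c0 := cred_size cc.
have [|L [k [lL Ll eWk ezk]]] := form l; first by rewrite /l; lia.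
have cw0 := fits_cred cc (fits_power L cc fv).
have z'1 : z' <> 1.
  move=> ez'; have x'1 : x' = 1 by apply/eqP; rewrite -(conjg_eq1 _ y'); apply/eqP.
  move: eW; rewrite ez' x'1 !expg1n mulg1 eWk => /esym/eqP; rewrite conjg_eq1 => /eqP.
  exact: cred_neq1.
have [b [u [cb fu formb]]] := two_run_form x0 y'^-1 z'1.
have b0 := cred_size cb.
have [|k' [eWk' ezk']] := formb l; first by rewrite /l; lia.
rewrite /z' conjgK in eWk'; rewrite -/z' in eWk'.
have cw1 := fits_cred cb (fits_power (l - 6) cb fu).
have ek : k * k'^-1 * wc (rt b 0 ((l - 6) * size b) ++ u) =
          wc (rt c 0 (L * size c) ++ v) * (k * k'^-1).
  apply: (@conjg_inj _ k'); rewrite !conjMg -eWk' eW eWk !conjgE; grp.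
(* The two cyclically reduced words are conjugate; a longer period b, repeated l - 6 times, would
   exceed the length of the word built on c. *)
have bc : size b <= size c.
  have := conj_cred_size x0 cw0 cw1 ek; rewrite !size_run => le.
  rewrite leqNgt; apply/negP => lt.
  have h1 : (l - 6) * (size c).+1 <= (l - 6) * size b by rewrite leq_mul2l lt orbT.
  have h2 : L * size c <= (l + e) * size c by rewrite leq_mul2r Ll orbT.
  have h3 : ((l - 6) * (size c).+1)%N = ((l - 6) * size c + (l - 6))%N by rewrite mulnS addnC.
  have h4 : ((l + e) * size c)%N = ((l - 6) * size c + (e + 6) * size c)%N.
    by rewrite -mulnDl; congr (_ * _)%N; rewrite /l; lia.
  move: h1 h2 h3 h4 le; have : (e + 6) * size c + size v < l - 6 by rewrite /l; lia.
  lia.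
have [||i [j ci]] := run_overlap cc cb cw0 cw1 ek bc; [rewrite /l in lL; lia|rewrite /l; lia|].
set w0 := rt c 0 _ ++ v in eWk cw0 ek ci.
set Wd := x ^+ 6 * z ^+ l in eW eWk eWk'.
have eWn n : (wc w0 ^- n) ^ k = Wd ^- n by rewrite conjVg conjXg -eWk.
have {ci} cz : commute z (z' ^ (Wd ^- j * Wd ^+ i)).
  apply/(commute_conj _ _ (Wd ^- i)); rewrite -conjgM mulgK.
  move/(commute_conj _ _ k): ci; rewrite !(conjJg _ (wc w0 ^- _) k) -ezk !eWn.
  by rewrite -[(_ ^ _^-1) ^ k]conjgM invgM invgK mulgVK -ezk'.
(* Since g centralizes [Wd], conjugating the solution by g keeps the equation and makes z' commute
   with z. *)
set g := Wd ^- j * Wd ^+ i in cz.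
have Wg : Wd ^ g = Wd.
  by apply/conjg_id_commute/commuteM; [apply/commuteV/commuteX|apply/commuteX].
have eW2 : (x' ^ g) ^+ 6 * (z' ^ g) ^+ l = x ^+ 6 * z ^+ l.
  by rewrite -(conjXg x') -(conjXg z') -conjMg eW.
set z2 := z' ^ g in cz eW2.
have cz2 : commute z (z / z2) by apply: commuteM => //; apply: commuteV.
have ex2 : (x' ^ g) ^+ 6 = x ^+ 6 * (z / z2) ^+ l.
  by rewrite expgnFl // mulgA -eW2 mulgK.
have [n0|n0] := pselect (z / z2 = 1).
  exists g^-1; have ez := divg1_eq n0.
  split; last by rewrite ez /z2 conjgK.
  have /(expg_inj x0 (isT : 0 < 6)) <- : (x' ^ g) ^+ 6 = x ^+ 6.
    by rewrite ex2 n0 expg1n mulg1.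
  by rewrite conjgK.
have x2b : wc b ^ (k' * y'^-1 * g) = x' ^ g.
  by rewrite !conjgM -ezk' /z' conjgK.
have [[|q] eq] := Cr _ cz2; first by case: n0; case: eq; rewrite expg0 ?invg1.
have qL : l <= q.+1 * l by apply: leq_pmull.
(* Here the sixth power of x' ^ g is x^6 times a power of r with exponent at least l in absolute
   value. Its cyclic length exceeds 6 size c, yet it is at most 6 size b. *)
suff [w [y2 [cw ew lw]]] : exists w y2,
    [/\ cred w, wc w ^ y2 = (x' ^ g) ^+ 6 & 6 * size c < size w].
  have := conj_run_bound cb cw x2b ew isT.
  by rewrite leqNgt (leq_ltn_trans _ lw) // leq_mul2l bc orbT.
have fin d w L2 (e' : nat) : cred d -> l <= L2 + e' -> 6 * size c + e' < l ->
    6 * size c < size (rt d 0 (L2 * size d) ++ w).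
  move=> cd h1 h2; rewrite size_run.
  by have := leq_pmulr L2 (cred_size cd); lia.
case: eq => eq.
  have [|L1 [k1 [h1 _ e3 _]]] := form1 (q.+1 * l)%N; first by rewrite (leq_trans _ qL) // /l; lia.
  exists (rt c1 0 (L1 * size c1) ++ v1), k1; split.
  - by apply: (fits_cred cc1); apply: fits_power.
  - by rewrite -e3 ex2 eq -expgnA.
  - by apply: (@fin _ _ _ e1) => //; [lia|rewrite /l; lia].
have [|L1 [k1 [h1 _ e3 _]]] := form2 (q.+1 * l)%N; first by rewrite (leq_trans _ qL) // /l; lia.
exists (rt c2 0 (L1 * size c2) ++ v2), k1; split.
- by apply: (fits_cred cc2); apply: fits_power.
- by rewrite -e3 ex2 eq -expVgn -expgnA.
- by apply: (@fin _ _ _ e2) => //; [lia|rewrite /l; lia].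
Qed.

End PairRigidity.

(** * Bounded overlaps and double cosets of centralizers *)

Section DoubleCosets.
Variables (X : choiceType) (x0 : X * bool).
Local Notation FX := (freeGroup X).
Local Notation wc := (@word_class X (fun _ => False)).
Implicit Types (g h k s t r u v x y z : FX).

Lemma cpl_mulr_ge g h : len (g * h) <= cpl g (g * h) + (len h).*2.
Proof.
have := cpl_mul x0 g h; have := cpl_lenr g^-1 h; have := len_mul_le x0 g h.
glia.
Qed.

Lemma cpl_mulr2_ge a b g h :
  cpl (a * g) (b * h) <= cpl a b + (len g).*2 + (len h).*2.
Proof.
have h1 := cpl_mulr_ge a g; have h2 := cpl_mulr_ge b h.
have h3 := cpl_ultra x0 a (a * g) (b * h); have h4 := cpl_ultra x0 a (b * h) b.
have h5 := cpl_lenl (a * g) (b * h); have h6 := cpl_lenr (a * g) (b * h).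
rewrite [cpl (b * h) b]cplC in h4; glia.
Qed.

(** A long common prefix of powers is a long overlap of two axes, and Fine-Wilf would make x and y
    commute. *)
Lemma power_overlap_bounded x y : ~ commute x y ->
  exists C, forall m n, cpl (x ^+ m) (y ^+ n) <= C.
Proof.
move=> nc.
have [ex|x1] := pselect (x = 1); first by case: nc; rewrite ex; apply/commute_sym/commute1.
have [ey|y1] := pselect (y = 1); first by case: nc; rewrite ey; apply/commute1.
have [h [p [cp ep]]] := cyclically_reduce x0 x1.
have [g [q [cq eq]]] := cyclically_reduce x0 y1.
exists (len h * 3 + len g * 3 + size p + size q)%N => m n.
rewrite leqNgt; apply/negP => lt; apply: nc.
have := @overlap_cpl_commute _ x0 p q h^-1 g^-1 m n cp cq.
rewrite !invgK -ep -eq; apply.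
have := cpl_mulr2_ge (h^-1 * wc p ^+ m) (g^-1 * wc q ^+ n) h g.
move: lt; rewrite ep eq -!conjXg !conjgE !mulgA !(len_inv x0).
glia.
Qed.

Lemma centralizer_overlap_bounded x y : ~ commute x y ->
  exists C, forall s t, commute x s -> commute y t -> cpl s t <= C.
Proof.
move=> nc.
have [ex|x1] := pselect (x = 1); first by case: nc; rewrite ex; apply/commute_sym/commute1.
have [ey|y1] := pselect (y = 1); first by case: nc; rewrite ey; apply/commute1.
have [a [xa Ca]] := centralizer_cyclic x0 x1.
have [b [yb Cb]] := centralizer_cyclic x0 y1.
have nab : ~ commute a b.
  move=> ab; apply: nc; have [ea|a1] := pselect (a = 1).
    by have [n] := Ca _ (commute_refl x); rewrite ea expg1n invg1 => -[] /x1.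
  have [eb|b1] := pselect (b = 1).
    by have [n] := Cb _ (commute_refl y); rewrite eb expg1n invg1 => -[] /y1.
  apply: (commute_trans x0 b1); last exact: commute_sym.
  exact: (commute_trans x0 a1 ab (commute_sym xa)).
have [C1 H1] := power_overlap_bounded nab.
have [|C2 H2] := @power_overlap_bounded a b^-1.
  by move=> /commuteV; rewrite invgK.
have nab' : ~ commute a^-1 b.
  by move=> /commute_sym/commuteV; rewrite invgK => /commute_sym.
have [C3 H3] := power_overlap_bounded nab'.
have [|C4 H4] := @power_overlap_bounded a^-1 b^-1.
  by move=> /commuteV; rewrite invgK.
exists (C1 + C2 + C3 + C4)%N => s t /Ca[m [->|->]] /Cb[n [->|->]].
- by apply: leq_trans (H1 m n) _; lia.
- by rewrite -expVgn; apply: leq_trans (H2 m n) _; lia.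
- by rewrite -(expVgn a); apply: leq_trans (H3 m n) _; lia.
- by rewrite -!expVgn; apply: leq_trans (H4 m n) _; lia.
Qed.

Lemma root_conj x : x <> 1 -> exists h c, [/\ cred c, commute x (wc c ^ h) &
  forall y, commute x y -> exists c' n, [/\ cred c', size c' = size c,
     wc c' = wc c \/ wc c' = (wc c)^-1 & y = (wc c' ^+ n) ^ h]].
Proof.
move=> x1; have [r [xr Cr]] := centralizer_cyclic x0 x1.
have r1 : r <> 1.
  by move=> er; have [n] := Cr _ (commute_refl x); rewrite er expg1n invg1 => -[] /x1.
have [h [c [cc er]]] := cyclically_reduce x0 r1.
exists h, c; split=> //; first by rewrite -er.
move=> y /Cr[n [->|->]].
  by exists c, n; split=> //; [left|rewrite er conjXg].
exists (inv_word c), n; split; first exact: cred_inv; first exact: size_inv_word.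
  by right; rewrite word_class_inv.
by rewrite er -word_class_inv expVgn conjVg conjXg.
Qed.

(** A long overlap first bounds len t, and then becomes an overlap of the axis of x with its
    translate by t. So t commutes with the root of x, and transitivity of commutation links v to
    x. *)
Lemma double_coset_overlap_bounded x v : ~ commute v x -> exists C, forall t a b,
  commute v t -> t <> 1 -> commute x a -> commute x b -> cpl (t * a) b <= C.
Proof.
move=> nc; have [C H] := centralizer_overlap_bounded nc.
have [ex|x1] := pselect (x = 1); first by case: nc; rewrite ex; apply/commute1.
have [h [c [cc xr Cr]]] := root_conj x1.
exists (C * 3 + len h * 8 + size c * 2)%N => t a b vt t1 xa xb.
rewrite leqNgt; apply/negP => lt.
have lt1 : len t <= C * 2.
  have h1 := cpl_ultra x0 t (t * a) b; have h2 := H t b vt xb.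
  have h3 := cpl_mul x0 t a; have h4 := H t^-1 a (commuteV vt) xa.
  glia.
have [c1 [m [cc1 s1 w1 ea]]] := Cr a xa.
have [c2 [n [cc2 s2 w2 eb]]] := Cr b xb.
have le : len (t * h^-1) + len h^-1 + (size c1 + size c2) <=
    cpl (t * h^-1 * wc c1 ^+ m) (h^-1 * wc c2 ^+ n).
  have := cpl_mulr2_ge (t * h^-1 * wc c1 ^+ m) (h^-1 * wc c2 ^+ n) h h.
  have := len_mul_le x0 t h^-1; rewrite s1 s2 !(len_inv x0).
  have <- : t * a = t * h^-1 * wc c1 ^+ m * h by rewrite ea conjgE !mulgA.
  have <- : b = h^-1 * wc c2 ^+ n * h by rewrite eb conjgE !mulgA.
  glia.
have := overlap_cpl_commute x0 cc1 cc2 le; rewrite !invgM !invgK conjgM.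
set r := wc c ^ h in xr.
have e1 : wc c1 ^ h = r \/ wc c1 ^ h = r^-1.
  by case: w1 => ->; [left|right; rewrite conjVg].
have e2 : wc c2 ^ h = r \/ wc c2 ^ h = r^-1.
  by case: w2 => ->; [left|right; rewrite conjVg].
move=> cm; have {cm} : commute r (r ^ t^-1).
  apply: commute_sym.
  have {}cm : commute (r ^ t^-1) (wc c2 ^ h).
    case: e1 cm => -> //; rewrite conjVg => /commute_sym/commuteV.
    by rewrite invgK => /commute_sym.
  by case: e2 cm => -> // /commuteV; rewrite invgK.
move/(commute_conj_self x0)/commuteV; rewrite invgK => rt.
apply: nc; have vr : commute v r by apply: (commute_trans x0 t1) => //; apply: commute_sym.
have r1 : r <> 1.
  by move=> /eqP; rewrite conjg_eq1 => /eqP; apply: cred_neq1.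
by apply: (commute_trans x0 r1); apply: commute_sym.
Qed.

Lemma len_expg_ge x : x <> 1 -> exists C, forall n, n <= len (x ^+ n) + C.
Proof.
move=> x1; have [h [c [cc ex]]] := cyclically_reduce x0 x1.
exists (len h).*2 => n.
have := len_expg x0 n cc; have c0 := cred_size cc.
have -> : wc c ^+ n = h * x ^+ n * h^-1 by rewrite ex -conjXg; grp.
have := len_mul_le x0 (h * x ^+ n) h^-1; have := len_mul_le x0 h (x ^+ n).
rewrite (len_inv x0); have := leq_pmulr n c0.
move: (n * size c)%N => q; glia.
Qed.

(* This removes the ambiguity, by centralizers, that remains when two test words
   share the entry x. *)
Lemma centralizer_double_coset u v x : ~ commute u x -> ~ commute v x ->
  exists K, forall s t r, commute u s -> commute v t -> commute x r ->
    s = x ^+ K * t * r -> s = 1.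
Proof.
move=> nu nv.
have [ex|x1] := pselect (x = 1); first by case: nu; rewrite ex; apply/commute1.
have [C1 H1] := centralizer_overlap_bounded nu.
have [C2 H2] := double_coset_overlap_bounded nv.
have [C3 H3] := len_expg_ge x1.
exists (C1 + C2 + C3).+1 => s t r us vt xr es; apply: contrapT => s1.
set K := _.+1 in es.
have xK : commute x (x ^+ K) by apply: commuteX.
have [et|t1] := pselect (t = 1).
  apply: nu; apply: (commute_trans x0 s1); apply: commute_sym => //.
  by rewrite es et mulg1; apply: commuteM.
have h1 := H1 s (x ^+ K) us xK.
have h2 := H2 t r (x ^- K) vt t1 xr (commuteV xK).
(* The two overlaps in [h3] add up to the length of x^K, which grows with K, while [h1] and [h2]
   bound them independently of K. *)
have h3 := cpl_mul x0 (x ^+ K) (t * r); rewrite mulgA -es in h3.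
have h4 := H3 K; rewrite [cpl s _]cplC in h1; rewrite cplC in h2.
have : C1 + C2 + C3 < K by [].
move: (K) h1 h2 h3 h4 => K'; glia.
Qed.

End DoubleCosets.

Lemma multiplicative1 (G H : groupType) (f : {multiplicative G -> H}) : f 1 = 1.
Proof. by apply: (@mulgI _ (f 1)); rewrite -gmulfM !mulg1. Qed.

Lemma multiplicativeV (G H : groupType) (f : {multiplicative G -> H}) :
  {morph f : x / x^-1}.
Proof. by move=> x; apply: (@mulIg _ (f x)); rewrite -gmulfM !mulVg multiplicative1. Qed.

Lemma multiplicativeJ (G H : groupType) (f : {multiplicative G -> H}) :
  {morph f : x y / x ^ y}.
Proof. by move=> x y; rewrite /conjg !gmulfM multiplicativeV. Qed.

Section Subst.
Variables (I : choiceType) (G : groupType) (c : I -> G).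

Lemma subst1 : subst c 1 = 1. Proof. exact: multiplicative1. Qed.
Lemma substV : {morph subst c : w / w^-1}. Proof. exact: multiplicativeV. Qed.
Lemma substX n : {morph subst c : w / w ^+ n}. Proof. by move=> w; elim: n => [|n IH]; rewrite ?subst1 // !expgS substM IH. Qed.
Lemma substJ : {morph subst c : v w / v ^ w}. Proof. exact: multiplicativeJ. Qed.

End Subst.

Lemma subst_ext (I : choiceType) (G : groupType) (f : freeGroup I -> G) (c : I -> G) :
  {morph f : v w / v * w} -> (forall i, f (free_gen i) = c i) -> f =1 subst c.
Proof.
move=> fM fc w.
have f1 : f 1 = 1 by apply: (@mulgI _ (f 1)); rewrite -fM !mulg1.
have fV v : f v^-1 = (f v)^-1 by apply: (@mulIg _ (f v)); rewrite -fM !mulVg.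
rewrite -[w]reprK -/(word_class _ _) /subst pres_liftE // word_classE.
elim: (repr w) => [|[i b] v IH]; first by rewrite /eval_word !big_nil.
rewrite /eval_word !big_cons fM -!/(eval_word _ _) IH; congr (_ * _).
by case: b => /=; rewrite ?fV fc.
Qed.

Lemma subst_conj (I : choiceType) (G : groupType) (c : I -> G) g w :
  subst (fun i => c i ^ g) w = subst c w ^ g.
Proof.
symmetry; apply: (@subst_ext _ _ (fun w => subst c w ^ g)) => [u v|i].
  by rewrite gmulfM conjMg.
by rewrite subst_gen.
Qed.

Lemma subst_const1 (I : choiceType) (G : groupType) (w : freeGroup I) :
  subst (fun=> 1 : G) w = 1.
Proof. by symmetry; apply: (@subst_ext _ _ (fun=> 1)) => // u v; rewrite mulg1. Qed.

(** * Test words *)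

Section TestWords.
Variables (X : choiceType) (x0 : X * bool).
Local Notation FX := (freeGroup X).
Variables (I : choiceType) (c : I -> FX).
Local Notation FI := (freeGroup I).
Local Notation val := (subst c).
Implicit Types (V W Y Z : FI) (S : FI -> Prop) (d : I -> FX) (g h : FX).

(* Test words relative to the fixed tuple c, on which V may depend. *)
Definition pins V S := forall d, subst d V = val V ->
  exists g, commute (val V) g /\ forall w, S w -> subst d w = val w ^ g.

Definition words (s : seq FI) : FI -> Prop := fun w => w \in s.

Lemma pins_conj V S : pins V S -> forall d h, subst d V = val V ^ h ->
  exists g, subst d V = val V ^ g /\ forall w, S w -> subst d w = val w ^ g.
Proof.
move=> P d h e; have [|g [cg Sg]] := P (fun i => d i ^ h^-1).
  by rewrite subst_conj e conjgK.
exists (g * h); split.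
  by rewrite e conjgM; move/conjg_id_commute: cg => ->.
by move=> w /Sg; rewrite subst_conj conjgM => <-; rewrite conjgKV.
Qed.

(** After conjugation a solution for [V ^ W] is one for V; as W is itself pinned, the resulting
    conjugator also fixes the value of [V ^ W]. *)
Lemma pinsJ V S W : pins V S -> S W -> pins (V ^ W) S.
Proof.
move=> P SW d e; have [|g [Vg Sg]] := @pins_conj _ _ P d (val W * (subst d W)^-1).
  by move: e; rewrite !substJ conjgM => <-; rewrite conjgK.
exists g; split => //; apply/conjg_id_commute.
by rewrite substJ conjJg -Vg -(Sg _ SW) -substJ e substJ.
Qed.

(** If V had value 1 at c, the trivial tuple would be a solution and W would have value 1 too. *)
Lemma pins_neq1 V S W : pins V S -> S W -> val W <> 1 -> val V <> 1.
Proof.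
move=> P SW W1 V1; have [|g [_ Sg]] := P (fun=> 1); first by rewrite subst_const1.
apply: W1; have := Sg _ SW; rewrite subst_const1 => /esym/eqP.
by rewrite conjg_eq1 => /eqP.
Qed.

Lemma commute_neq1 (G : groupType) (x y : G) : ~ commute x y -> x <> 1 /\ y <> 1.
Proof.
move=> nc; split=> e; apply: nc; rewrite e; first exact/commute_sym/commute1.
exact: commute1.
Qed.

(* V = Y^6 (Y^Z)^l only pins Y and Y^Z; testing V in turn against Y^-K Z
   recovers Z. *)
Lemma pins_pair Y Z : ~ commute (val Y) (val Z) -> exists V,
  pins V (words [:: Y; Z]) /\ ~ commute (val V) (val Y).
Proof.
move=> nc; set x := val Y in nc *; set y := val Z in nc *.
have [l l0 rigid] := pair_rigidity x0 nc.
pose V := Y ^+ 6 * (Y ^ Z) ^+ l; pose v := val V.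
have vE d : subst d V = subst d Y ^+ 6 * (subst d Y ^ subst d Z) ^+ l.
  by rewrite /V substM !substX substJ.
have xy : ~ commute x (x ^ y) by move/(commute_conj_self x0).
have vx : ~ commute v x.
  rewrite /v vE => cv; apply: nc; apply: (expg_conj_commute x0 l0).
  have := commuteM (commuteV (commuteX 6 (commute_refl x))) (commute_sym cv).
  by rewrite mulKg.
have vxy : ~ commute v (x ^ y).
  rewrite /v vE => cv; apply: xy; apply: (@expg_commute _ x0 _ _ 6) => //.
  apply: commute_sym.
  have := commuteM (commute_sym cv) (commuteV (commuteX l (commute_refl (x ^ y)))).
  by rewrite mulgK.
have [v1 x1] := commute_neq1 vx.
have ux : ~ commute (v ^ y^-1) x.
  by rewrite -[x](conjgK y) => /commute_conj.
have [K HK] := centralizer_double_coset x0 ux vx.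
pose T := Y ^- K * Z.
have tE d : subst d T = subst d Y ^- K * subst d Z.
  by rewrite /T substM substV substX.
have vt : ~ commute v (val T).
  rewrite tE => /conjg_id_commute; rewrite conjgM => e.
  apply: v1; apply/eqP; rewrite -(conjg_eq1 _ y^-1); apply/eqP.
  apply: (HK _ v (x ^- K)) => //; first exact/commuteV/commuteX.
  by rewrite -{1}e conjgK conjgE invgK mulgA.
have [m m0 rigid2] := pair_rigidity x0 vt.
pose V2 := V ^+ 6 * (V ^ T) ^+ m.
have v2E d : subst d V2 = subst d V ^+ 6 * (subst d V ^ subst d T) ^+ m.
  by rewrite /V2 substM !substX substJ.
have xK : commute x (x ^+ K) by apply: commuteX.
have P2 : pins V2 (words [:: Y; Z]).
  move=> d ed; have [|g0 [eV eVT]] := rigid2 (subst d V) (subst d T).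
    by move: ed; rewrite !v2E.
  exists g0; split.
    by apply/conjg_id_commute; rewrite -[RHS]ed !v2E eVT eV conjMg -!conjXg.
  (* With the outer conjugator undone, three errors remain: g for Y, r for Z and t for T. *)
  pose d' i := d i ^ g0^-1.
  have d'E w : subst d w = subst d' w ^ g0 by rewrite subst_conj conjgKV.
  rewrite d'E in eV; move/conjg_inj: eV => eV.
  rewrite !d'E eV -conjJg in eVT; move/conjg_inj: eVT => eVT.
  have [|g [eY eYZ]] := rigid (subst d' Y) (subst d' Z); first by rewrite -vE eV /v vE.
  have vg : commute v g.
    by apply/conjg_id_commute; rewrite -[RHS]eV vE eYZ eY /v vE conjMg -!conjXg.
  pose r := g * subst d' Z * g^-1 * y^-1.
  have xr : commute x r.
    by apply/conjg_id_commute; rewrite /r !conjgM -eY eYZ !conjgK.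
  pose t := subst d' T * (val T)^-1.
  have ct : commute v t.
    by apply/conjg_id_commute; rewrite /t conjgM eVT conjgK.
  have eg : g * t = x ^- K * r * (g ^ y^-1) * x ^+ K.
    by rewrite /t !tE eY -/x -/y -conjXg -conjVg /r; grp.
  (* [eg] is a double coset equation between the centralizers of [v ^ y^-1], v and x, for which K
     was chosen. Once g = 1 it gives t = r, an element commuting with both v and x, hence
     trivial. *)
  have g1 : g = 1.
    apply/eqP; rewrite -(conjg_eq1 _ y^-1) -invg_eq1; apply/eqP.
    apply: (HK _ (g * t)^-1 (x ^- K * r)).
    - by apply/commuteV/commute_conj.
    - by apply/commuteV/commuteM.
    - by apply: commuteM => //; apply: commuteV.
    by rewrite eg; grp.
  have etr : t = r.
    move: eg; rewrite g1 conj1g mul1g mulg1 => ->.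
    by rewrite -(commuteV (commuteX K (commute_sym xr))) mulgVK.
  have r1 : r = 1.
    apply: contrapT => r1; apply: vx; apply: (commute_trans x0 r1); apply: commute_sym => //.
    by rewrite -etr.
  move=> w; rewrite /words !inE => /orP[] /eqP ->; rewrite d'E; congr (_ ^ g0).
    by rewrite eY g1 conjg1.
  by move: r1; rewrite /r g1 mul1g invg1 mulg1 => /divg1_eq.
(* If both V2 and its conjugate by y commuted with x, then V2 would commute with its own conjugate,
   hence with y, and x with y. *)
have [c2|nc2] := pselect (commute (val V2) x); last by exists V2.
exists (V2 ^ Z); split; first by apply: pinsJ => //; rewrite /words !inE eqxx orbT.
rewrite substJ -/y => c3; apply: nc.
have V21 : val V2 <> 1 by apply: (pins_neq1 P2 (W := Y)); rewrite /words ?inE ?eqxx.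
have c4 := commute_trans x0 x1 (commute_sym c2) (commute_sym c3).
by apply: (commute_trans x0 V21) => //; apply: (commute_conj_self x0).
Qed.

(** Separate words A for (Y, Z) and B for (Y, W) leave conjugators s and s' that agree on Y. Testing
    A against the shifted word C = B ^ (Y ^- K) makes s' centralize the value of C as well, and the
    double coset lemma kills both. *)
Lemma pins_triple Y Z W : ~ commute (val Y) (val Z) -> exists V,
  pins V (words [:: Y; Z; W]).
Proof.
(* If W commutes with Y, then W Z does not, and W is recovered from W Z and Z. *)
move=> nc; wlog nw : W / ~ commute (val Y) (val W).
  move=> wl; have [cw|] := pselect (commute (val Y) (val W)); last exact: wl.
  have [|V PV] := wl (W * Z).
    rewrite substM => c2; apply: nc; have := commuteM (commuteV cw) c2.
    by rewrite mulKg.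
  exists V => d /PV[g [Vg Sg]]; exists g; split => // w.
  have eZ : subst d Z = val Z ^ g by apply: Sg; rewrite /words !inE eqxx orbT.
  rewrite /words !inE => /or3P[] /eqP -> //; first by apply: Sg; rewrite /words !inE eqxx.
  have : subst d (W * Z) = val (W * Z) ^ g by apply: Sg; rewrite /words !inE eqxx !orbT.
  by rewrite !substM conjMg eZ => /mulIg.
have [A [PA nA]] := pins_pair nc; have [B [PB nB]] := pins_pair nw.
set x := val Y in nc nw nA nB *; set a := val A in nA *; set b := val B in nB *.
have [K HK] := centralizer_double_coset x0 nA nB.
have [b1 x1] := commute_neq1 nB.
pose C := B ^ (Y ^- K).
have CE d : subst d C = subst d B ^ (subst d Y ^- K) by rewrite substJ substV substX.
have xK : commute x (x ^- K) by apply/commuteV/commuteX.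
have nC : ~ commute a (val C).
  rewrite CE -/x -/b => cb; apply: b1; apply/eqP; rewrite -(conjg_eq1 _ (x ^- K)); apply/eqP.
  by apply: (HK _ b (x ^- K)) => //; rewrite conjgE invgK mulgA.
have [V [PV _]] := pins_pair nC.
exists V => d /PV[g0 [Vg Sg]]; exists g0; split => //.
pose d' i := d i ^ g0^-1.
have d'E w : subst d w = subst d' w ^ g0 by rewrite subst_conj conjgKV.
have eA : subst d' A = a.
  by apply: (@conjg_inj _ g0); rewrite -d'E Sg // /words !inE eqxx.
have eC : subst d' C = val C.
  by apply: (@conjg_inj _ g0); rewrite -d'E Sg // /words !inE eqxx orbT.
have [s [as_ Ss]] := PA d' eA.
have [|s' [eB Ss']] := @pins_conj _ _ PB d' (x ^- K * (subst d' Y ^+ K)).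
  rewrite conjgM; apply: (canRL (conjgKV _)).
  by rewrite -CE eC CE.
have eY : subst d' Y = x ^ s by apply: Ss; rewrite /words !inE eqxx.
have eY' : subst d' Y = x ^ s' by apply: Ss'; rewrite /words !inE eqxx.
pose t := s' ^ (x ^+ K).
have bt : commute b t.
  apply/(commute_conj _ _ (x ^- K)); rewrite /t conjgK.
  apply/conjg_id_commute; rewrite -/b.
  by have := eC; rewrite !CE eB eY' -/x -/b -conjXg -conjVg -conjJg.
pose r := s * s'^-1.
have xr : commute x r.
  by apply/conjg_id_commute; rewrite /r conjgM -eY eY' conjgK.
have es : s^-1 = x ^+ K * t^-1 * (x ^- K * r^-1).
  by rewrite /t /r; grp.
have s1 : s = 1.
  apply/eqP; rewrite -invg_eq1; apply/eqP; apply: (HK _ t^-1 (x ^- K * r^-1)) => //.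
  - exact/commuteV.
  - exact/commuteV.
  - by apply: commuteM => //; apply: commuteV.
have s'1 : s' = 1.
  apply: contrapT => s'1; apply: nB.
  have t1 : t <> 1 by move=> /eqP; rewrite conjg_eq1 => /eqP.
  apply: (commute_trans x0 t1); apply: commute_sym => //.
  have xs' : commute x s'.
    by rewrite /r s1 mul1g in xr; rewrite -[s']invgK; apply: commuteV.
  by rewrite /t conjgE; apply: commuteM; [apply: commuteV; apply: commuteX|apply: commuteM => //; apply: commuteX].
move=> w; rewrite /words !inE => /or3P[] /eqP ->; rewrite d'E; congr (_ ^ g0).
- by rewrite eY s1 conjg1.
- by rewrite Ss ?s1 ?conjg1 // /words !inE eqxx orbT.
- by rewrite Ss' ?s'1 ?conjg1 // /words !inE eqxx orbT.
Qed.

(** V for the old words and T for the new one leave conjugators a and b. They agree on the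
    non-commuting pair Y, Z, so a = b; this element commutes with the values of both V and T, which
    do not commute, so it is 1. *)
Lemma pins_seq Y Z s : ~ commute (val Y) (val Z) -> exists V,
  pins V (words [:: Y, Z & s]).
Proof.
move=> nc; elim: s => [|W s [V PV]].
  by have [V [PV _]] := pins_pair nc; exists V.
have [V' PV'] := pins_triple W nc.
have [y1 z1] := commute_neq1 nc.
have inY l : words (Y :: l) Y by rewrite /words !inE eqxx.
have inZ l : words [:: Y, Z & l] Z by rewrite /words !inE eqxx orbT.
have V1 := pins_neq1 PV (inY _) y1; have V'1 := pins_neq1 PV' (inY _) y1.
(* Among V', V' ^ Y and V' ^ Z some word fails to commute with V: otherwise V' would commute with
   both conjugates, hence with Y and Z. *)
have {V' PV' V'1} [T [PT nT]] : exists T,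
    pins T (words [:: Y; Z; W]) /\ ~ commute (val V) (val T).
  apply: contrapT => no.
  have cT T : pins T (words [:: Y; Z; W]) -> commute (val V) (val T).
    by move=> PT; apply: contrapT => nT; apply: no; exists T.
  have c1 := cT _ PV'; have c2 := cT _ (pinsJ PV' (inY _)).
  have c3 := cT _ (pinsJ PV' (inZ _)).
  rewrite !substJ in c2 c3.
  have c4 := commute_conj_self x0 (commute_trans x0 V1 c1 c2).
  have c5 := commute_conj_self x0 (commute_trans x0 V1 c1 c3).
  exact: nc (commute_trans x0 V'1 c4 c5).
have [R [PR _]] := pins_pair nT.
exists R => d /PR[g0 [Rg Sg]]; exists g0; split => //.
pose d' i := d i ^ g0^-1.
have d'E w : subst d w = subst d' w ^ g0 by rewrite subst_conj conjgKV.
have eV : subst d' V = val V.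
  by apply: (@conjg_inj _ g0); rewrite -d'E Sg // /words !inE eqxx.
have eT : subst d' T = val T.
  by apply: (@conjg_inj _ g0); rewrite -d'E Sg // /words !inE eqxx orbT.
have [a [Va Sa]] := PV d' eV; have [b [Tb Sb]] := PT d' eT.
have ab : a = b.
  apply: contrapT => ab; apply: nc.
  have ab1 : a * b^-1 <> 1 by move/divg1_eq.
  apply: (commute_trans x0 ab1); apply: commute_sym; apply/conjg_id_commute.
    by rewrite conjgM -Sa // Sb // conjgK.
  by rewrite conjgM -Sa // Sb // conjgK.
have a1 : a = 1.
  apply: contrapT => a1; apply: nT; apply: (commute_trans x0 a1); apply: commute_sym => //.
  by rewrite ab.
move=> w; rewrite /words !inE d'E => /or4P[] h; congr (_ ^ g0).
- by rewrite (eqP h) Sa // a1 conjg1.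
- by rewrite (eqP h) Sa // a1 conjg1.
- by rewrite (eqP h) Sb -?ab ?a1 ?conjg1 // /words !inE eqxx !orbT.
- by rewrite Sa ?a1 ?conjg1 // /words !inE h !orbT.
Qed.

End TestWords.

(** * Non-trivial words have non-trivial values in free groups *)

Section Laws.
Variable X : choiceType.
Local Notation FX := (freeGroup X).
Local Notation wc := (@word_class X (fun _ => False)).
Implicit Types (x y : X) (l : X * bool).
Local Notation ok := (fun a b : X * bool => b != letter_inv a).

Lemma word_class_letter x b :
  wc [:: (x, b)] = if b then (free_gen x)^-1 else free_gen x.
Proof. by rewrite word_classE /eval_word big_seq1. Qed.

Lemma word_class_nseq x b n : wc (nseq n (x, b)) = wc [:: (x, b)] ^+ n.
Proof. by elim: n => // n IH; rewrite -[nseq _ _]cat1s word_class_cat IH expgS. Qed.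

Lemma path_nseq l n s : path ok l s -> path ok l (nseq n l ++ s).
Proof. by move=> p; elim: n => //= n ->; rewrite andbT eq_sym letter_inv_neq. Qed.

Lemma ok_neq x y b b' : x != y -> ok (x, b) (y, b').
Proof. by move=> ne; rewrite /letter_inv xpair_eqE eq_sym (negbTE ne). Qed.

Variables (x y : X).
Hypothesis xy : x != y.

(* Cancellation in a product of conjugates of x by distinct powers of y never
   reaches the letters x. *)
Lemma law_prefix r i b (w : word 'I_r) : reduced ((i, b) :: w) -> exists s,
  reduced (nseq i.+1 (y, false) ++ (x, b) :: s) /\
  eval_word (fun i : 'I_r => free_gen x ^ (free_gen y ^- i.+1)) ((i, b) :: w) =
  wc (nseq i.+1 (y, false) ++ (x, b) :: s).
Proof.
set c := (fun i : 'I_r => _); have yx : y != x by rewrite eq_sym.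
have yT : wc [:: (y, true)] = (free_gen y)^-1 := word_class_letter y true.
have yF : wc [:: (y, false)] = free_gen y := word_class_letter y false.
have cE j e : (if e then (c j)^-1 else c j) =
    free_gen y ^+ j.+1 * wc [:: (x, e)] * free_gen y ^- j.+1.
  rewrite /c conjgE invgK word_class_letter.
  by move: (free_gen y ^+ j.+1) => p; case: e; grp.
elim: w i b => [|[j b'] w IH] i b red.
  exists (nseq i.+1 (y, true)); split.
    rewrite /reduced /=; apply: path_nseq; rewrite /= ok_neq //=.
    by rewrite ok_neq //= -[nseq i _]cats0; apply: path_nseq.
  rewrite -(cat1s (x, b)) !word_class_cat !word_class_nseq yT yF expVgn.
  by rewrite /eval_word big_seq1 cE mulgA.
have [e1 red'] : (j, b') != letter_inv (i, b) /\ reduced ((j, b') :: w) by case/andP: red.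
have [s [rs es]] := IH j b' red'.
have ps : path ok (x, b') s.
  by have := rs; rewrite /reduced /= cat_path => /andP[_ /= /andP[]].
have [M [pM eM]] : exists M, path ok (x, b) (M ++ (x, b') :: s) /\
    wc M = free_gen y ^- i.+1 * free_gen y ^+ j.+1.
  case: (ltngtP i j) => [lt|lt|/val_inj e].
  - exists (nseq (j - i).-1.+1 (y, false)); split.
      by rewrite /= ok_neq //=; apply: path_nseq; rewrite /= ok_neq.
    rewrite word_class_nseq yF.
    apply: (canRL (mulKg _)); rewrite -expgnDr; congr (_ ^+ _); lia.
  - exists (nseq (i - j).-1.+1 (y, true)); split.
      by rewrite /= ok_neq //=; apply: path_nseq; rewrite /= ok_neq.
    rewrite word_class_nseq yT expVgn.
    have -> : i.+1 = (j.+1 + (i - j).-1.+1)%N by lia.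
    by rewrite expgnDr invgM mulgVK.
  - exists [::]; split; last by rewrite -e mulVg.
    rewrite /= ps andbT; move: e1; rewrite -e /letter_inv !xpair_eqE !eqxx /=.
    by [].
exists (M ++ (x, b') :: s); split.
  by rewrite /reduced /=; apply: path_nseq; rewrite /= ok_neq.
rewrite /eval_word big_cons -/(eval_word c _) es.
rewrite -(cat1s (x, b)) -(cat1s (x, b')) !word_class_cat.
rewrite eM !word_class_nseq yF cE.
by rewrite !mulgA.
Qed.

(** The elements y^(i+1) x y^-(i+1) freely generate a subgroup. *)
Lemma nontrivial_value r (w : freeGroup 'I_r) : w <> 1 ->
  exists c : 'I_r -> FX, subst c w <> 1.
Proof.
move=> w1; exists (fun i => free_gen x ^ (free_gen y ^- i.+1)).
have : reduced (nf w) by apply: nf_reduced.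
rewrite -[w in subst _ w](nfK w) /subst pres_liftE //.
case E: (nf w) => [|[i b] v]; first by case: w1; rewrite -[w]nfK E.
move=> /law_prefix[s [rs ->]] /(congr1 (@nf X)).
by rewrite nf1 nf_id.
Qed.

End Laws.

Lemma freeGroup_abelian (X : choiceType) : (forall x y : X, x = y) ->
  forall a b : freeGroup X, commute a b.
Proof.
move=> all1 a b; rewrite -[a]nfK -[b]nfK.
have gens l l' : commute (@word_class X (fun=> False) [:: l])
    (@word_class X (fun=> False) [:: l']).
  case: l l' => x c [x' c']; rewrite (all1 x' x) !word_class_letter.
  by case: c c' => [] [] //=; rewrite /commute ?mulVg ?mulgV.
elim: (nf a) => [|l u IH]; first exact/commute_sym/commute1.
rewrite -cat1s word_class_cat; apply: commute_sym; apply: commuteM; last first.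
  exact: commute_sym.
apply: commute_sym; elim: (nf b) => [|l' v IHv]; first exact: commute1.
by rewrite -(cat1s l') word_class_cat; apply: commuteM.
Qed.

Lemma subst_comp (I : choiceType) (G K : groupType) (f : {multiplicative G -> K})
  (c : I -> G) w : f (subst c w) = subst (fun i => f (c i)) w.
Proof.
apply: (@subst_ext _ _ (fun w => f (subst c w))) => [u v|i]; last by rewrite subst_gen.
by rewrite substM gmulfM.
Qed.

(** * Transfer to an abstract non-abelian free group *)

Section FreeGroups.
Variable F : groupType.
Hypotheses (F_free : is_free F) (F_nonab : non_abelian F).

Lemma free_basis : exists (X : choiceType) (x y : X) (f : {multiplicative freeGroup X -> F})
  (f' : F -> freeGroup X), [/\ x != y, cancel f f' & cancel f' f].
Proof.
have [X [f [f' fK f'K]]] := F_free.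
have [[x [y xy]]|no] := pselect (exists x y : X, x <> y).
  by exists X, x, y, f, f'; split => //; apply/eqP.
case: F_nonab => u v; rewrite -[u]f'K -[v]f'K; apply: gmulf_commute.
apply: freeGroup_abelian => x y; apply: contrapT => xy; apply: no.
by exists x, y.
Qed.

Lemma free_nontrivial_value r (w : freeGroup 'I_r) : w <> 1 ->
  exists c : 'I_r -> F, subst c w <> 1.
Proof.
have [X [x [y [f [f' [xy fK f'K]]]]]] := free_basis.
move=> /(nontrivial_value xy)[c c1]; exists (fun i => f (c i)).
by rewrite -subst_comp => e; apply/c1/(can_inj fK); rewrite e multiplicative1.
Qed.

(** Otherwise [commute_conj_self] makes a central, and a group with transitive commutation would be
    abelian. *)
Lemma free_noncommuting_conjugate (a : F) : a <> 1 -> exists h, ~ commute a (a ^ h).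
Proof.
have [X [x [y [f [f' [xy fK f'K]]]]]] := free_basis.
move=> a1; apply: contrapT => no; apply: F_nonab => u v.
have ca h : commute (f' a) h.
  apply: (commute_conj_self (x, true)); rewrite -[h]fK.
  apply: contrapT => nc; apply: no; exists (f h) => c; apply: nc.
  apply: (can_inj fK); move: c.
  by rewrite /commute !gmulfM multiplicativeV !f'K.
have fa1 : f' a <> 1 by move=> e; apply: a1; rewrite -[a]f'K e multiplicative1.
rewrite -[u]f'K -[v]f'K; apply: gmulf_commute.
exact: (commute_trans (x, true) fa1).
Qed.

Lemma free_test_word m (c : 'I_m -> F) i j : ~ commute (c i) (c j) ->
  exists V : freeGroup 'I_m, forall d, subst d V = subst c V ->
    exists g, forall k, d k = c k ^ g.
Proof.
have [X [x [y [f [f' [xy fK f'K]]]]]] := free_basis.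
move=> nc; pose c' k := f' (c k).
have [|V PV] := @pins_seq X (x, true) _ c' (free_gen i) (free_gen j) [seq free_gen k | k : 'I_m].
  by rewrite !subst_gen => e; apply: nc; rewrite -[c i]f'K -[c j]f'K; apply: gmulf_commute.
exists V => d e; have [|g [_ Sg]] := PV (fun k => f' (d k)).
  apply: (can_inj fK); rewrite !subst_comp.
  have -> : (fun k => f (f' (d k))) = d by apply/funext => k; rewrite f'K.
  by have -> : (fun k => f (c' k)) = c by apply/funext => k; rewrite f'K.
exists (f g) => k; have := Sg (free_gen k); rewrite !subst_gen => Sk.
rewrite -[d k]f'K Sk ?multiplicativeJ ?f'K //.
by rewrite /words !inE map_f ?orbT // mem_enum.
Qed.

End FreeGroups.

(** * Verbal closedness and divisible subgroups *)

Section Generated.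
Variable G : groupType.
Implicit Types (A B : set G) (x y : G).

Lemma subgroupP A : subgroup A <-> A 1 /\ forall x y, A x -> A y -> A (x * y^-1).
Proof.
split=> [[A1 AB]|[A1 AB]]; split.
- exact: set_mem.
- by move=> x y Ax Ay; apply/set_mem/AB; apply/mem_set.
- exact/mem_set.
- by move=> x y /set_mem Ax /set_mem Ay; apply/mem_set/AB.
Qed.

Lemma generated_ind A (P : G -> Prop) : P 1 ->
  (forall x y, P x -> P y -> P (x * y^-1)) -> (forall x, A x -> P x) ->
  forall x, generated A x -> P x.
Proof.
move=> P1 PB PA x gx; apply: (gx [set y | P y]); split; last exact: PA.
exact/subgroupP.
Qed.

Lemma generated_sub A x : A x -> generated A x.
Proof. by move=> Ax B [_ AB]; apply: AB. Qed.

Lemma subgroupV A x : subgroup A -> A x -> A x^-1.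
Proof. by move=> /subgroupP[A1 AB] Ax; rewrite -[x^-1]mul1g; apply: AB. Qed.

Lemma subgroupM A x y : subgroup A -> A x -> A y -> A (x * y).
Proof.
move=> sA Ax Ay; have /subgroupP[_ AB] := sA.
by rewrite -[y]invgK; apply: AB => //; apply: subgroupV.
Qed.

Lemma derived_subgroup : subgroup (derived G).
Proof. exact: subgroup_generated. Qed.

Lemma derivedR x y : derived G [~ x, y].
Proof. by apply: generated_sub; exists x => //; exists y. Qed.

Lemma derived_ind (P : G -> Prop) : P 1 ->
  (forall x y, P x -> P y -> P (x * y^-1)) -> (forall x y, P [~ x, y]) ->
  forall x, derived G x -> P x.
Proof.
move=> P1 PB PR x Dx; apply: (generated_ind P1 PB _ Dx) => _ [u _ [v _ <-]]; exact: PR.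
Qed.

End Generated.

Lemma derived_morph (G K : groupType) (f : {multiplicative G -> K}) x :
  derived G x -> derived K (f x).
Proof.
have sD := derived_subgroup K.
move: x; apply: (@derived_ind _ (fun x => derived K (f x))) => [|x y Dx Dy|x y].
- by rewrite multiplicative1; have /subgroupP[] := sD.
- by rewrite gmulfM multiplicativeV; apply: (subgroupM sD) => //; apply: (subgroupV sD).
rewrite /commg gmulfM multiplicativeV multiplicativeJ; exact: derivedR.
Qed.

Section EvalWord.
Variables (Y : choiceType) (G : groupType).

Lemma eval_word_morph (K : groupType) (f : G -> K) (c : Y -> G) w :
  {morph f : x y / x * y} -> f (eval_word c w) = eval_word (fun y => f (c y)) w.
Proof.
move=> fM; have f1 : f 1 = 1 by apply: (@mulgI _ (f 1)); rewrite -fM !mulg1.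
have fV v : f v^-1 = (f v)^-1 by apply: (@mulIg _ (f v)); rewrite -fM !mulVg.
elim: w => [|[y b] w IH]; first by rewrite /eval_word !big_nil.
rewrite /eval_word !big_cons fM -!/(eval_word _ _) IH; congr (_ * _).
by case: b => /=; rewrite ?fV.
Qed.

Lemma eq_eval_word (c c' : Y -> G) w : (forall p, p \in w -> c p.1 = c' p.1) ->
  eval_word c w = eval_word c' w.
Proof.
move=> e; rewrite /eval_word big_seq [RHS]big_seq; apply: eq_bigr => p /e ->.
by [].
Qed.

Lemma eval_word_mod (Q : set G) (c c' : Y -> G) w : subgroup Q -> Q `<=` center G ->
  (forall p, p \in w -> exists2 q, Q q & c' p.1 = c p.1 * q) ->
  exists2 q, Q q & eval_word c' w = eval_word c w * q.
Proof.
move=> sQ cQ; have /subgroupP[Q1 _] := sQ.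
elim: w => [|[y b] w IH] e; first by exists 1; rewrite // /eval_word !big_nil mulg1.
have [|q Qq eq] := IH; first by move=> p pw; apply: e; rewrite inE pw orbT.
have [/= q' Qq' eq'] := e (y, b) (mem_head _ _).
rewrite /eval_word !big_cons -!/(eval_word _ _) /= eq.
case: b {e}.
  exists (q'^-1 * q); first by apply: subgroupM => //; apply: subgroupV.
  rewrite eq' invgM (cQ _ (subgroupV sQ Qq')) -!mulgA; congr (_ * _).
  by rewrite !mulgA (cQ _ (subgroupV sQ Qq')).
exists (q' * q); first exact: subgroupM.
by rewrite eq' -!mulgA; congr (_ * _); rewrite !mulgA (cQ _ Qq').
Qed.

End EvalWord.

Section VerballyClosed.
Variables (H G : groupType) (iota : {multiplicative H -> G}).
Hypothesis iota_closed : verbally_closed iota.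

Lemma verbally_closed_any (Y : choiceType) (w : freeGroup Y) h :
  (exists g : Y -> G, subst g w = iota h) -> exists e : Y -> H, subst e w = h.
Proof.
move=> [g eg]; pose s := [seq p.1 | p <- repr w].
(* The successor keeps the ordinal type inhabited for [inord]; letters not occurring in w all go to
   the last index. *)
pose idx y : 'I_(size s).+1 := inord (index y s).
pose w' := subst (fun y => free_gen (idx y)) w.
have substE (K : groupType) (c : 'I_(size s).+1 -> K) : subst c w' = subst (fun y => c (idx y)) w.
  rewrite /w' (subst_comp (subst c)); congr (subst _ w); apply/funext => y.
  exact: subst_gen.
have [|e ee] := @iota_closed _ w' h.
  exists (fun k => nth 1 [seq g y | y <- s] k); rewrite -eg substE.
  apply: eq_eval_word => p pw.
  have ps : p.1 \in s by apply: map_f.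
  have lt : index p.1 s < size s by rewrite index_mem.
  by rewrite /= inordK ?ltnS ?(ltnW lt) // (nth_map p.1) // nth_index.
by exists (fun y => e (idx y)); rewrite -substE.
Qed.

(** A product of commutators in G is the value of a word in the derived subgroup of a free group.
    Closedness gives this word the same value at elements of H. *)
Lemma verbally_closed_derived h : derived G (iota h) -> derived H h.
Proof.
move=> Dh; have [w Dw ew] : exists2 w : freeGroup G, derived _ w & subst id w = iota h.
  move: Dh; move: (iota h) => x.
  have sD := derived_subgroup (freeGroup G).
  move: x; apply: (@derived_ind _ (fun x =>
    exists2 w : freeGroup G, derived _ w & subst id w = x)) => [|_ _ [u Du <-] [v Dv <-]|x y].
  - by exists 1; [have /subgroupP[] := sD|exact: subst1].
  - exists (u * v^-1); last by rewrite substM substV.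
    by apply: (subgroupM sD) => //; apply: (subgroupV sD).
  exists [~ free_gen x, free_gen y]; first exact: derivedR.
  by rewrite /commg substM substV substJ !subst_gen.
have [|e <-] := @verbally_closed_any _ w h; first by exists id.
exact: derived_morph.
Qed.

End VerballyClosed.

(** * Extending the identity of a central divisible subgroup *)

Section DivisibleExtension.
Variables (H G : groupType) (iota : {multiplicative H -> G}) (Q : set H).
Hypotheses (Q_subgroup : subgroup Q) (Q_divisible : divisible Q).
Hypotheses (Q_central : Q `<=` center H).
Hypothesis Q_derived : forall q, Q q -> derived G (iota q) -> q = 1.

(* Graphs of homomorphisms to Q defined on subgroups of G. *)
Definition partial_hom (M : set (G * H)) := [/\ forall a x, M (a, x) -> Q x,
  forall a x b y, M (a, x) -> M (b, y) -> M (a * b^-1, x * y^-1) &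
  forall x, M (1, x) -> x = 1].

(** The map q d -> q on Q G', well defined by [Q_derived]. Containing G' makes every larger domain
    normal and sends commutators to 1, which replaces commutativity of G. *)
Definition base_hom : set (G * H) :=
  [set ax | Q ax.2 /\ exists2 d, derived G d & ax.1 = iota ax.2 * d].

Let Q1 : Q 1. Proof. by have /subgroupP[] := Q_subgroup. Qed.
Let D1 : derived G 1. Proof. by have /subgroupP[] := derived_subgroup G. Qed.

Lemma base_hom_partial : partial_hom base_hom.
Proof.
have sD := derived_subgroup G; split.
- by move=> a x [].
- move=> _ x _ y [/= Qx [d Dd ->]] [/= Qy [d' Dd' ->]]; split => /=.
    by apply: subgroupM => //; apply: subgroupV.
  pose d2 := d * d'^-1.
  have Dd2 : derived G d2 by apply: (subgroupM sD) => //; apply: (subgroupV sD).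
  exists (d2 * [~ d2, (iota y)^-1]); first by apply: (subgroupM sD) => //; apply: derivedR.
  by rewrite gmulfM multiplicativeV commgEl mulVKg /d2; grp.
move=> x [/= Qx [d Dd e]]; apply: Q_derived => //.
have -> : iota x = d^-1 by apply: (@mulIg _ d); rewrite -e mulVg.
exact: (subgroupV sD).
Qed.

(** As in the abelian case: if a positive power of g lies in the domain, the least such power has a
    value in Q, and divisibility supplies the root needed as the value of g; otherwise g is sent to
    1. *)
Lemma partial_hom_extend M : base_hom `<=` M -> partial_hom M ->
  forall g, exists M', [/\ M `<=` M', partial_hom M' & exists x, M' (g, x)].
Proof.
move=> bM [MQ MB M1] g.
have bc d : derived G d -> M (d, 1).
  by move=> Dd; apply: bM; split => //=; exists d; rewrite ?multiplicative1 ?mul1g.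
have M11 : M (1, 1) by apply: bc.
have MV a x : M (a, x) -> M (a^-1, x^-1).
  by move=> Max; rewrite -[a^-1]mul1g -[x^-1]mul1g; apply: MB.
have MM a x b y : M (a, x) -> M (b, y) -> M (a * b, x * y).
  by move=> Ma Mb; rewrite -[b]invgK -[y]invgK; apply: MB => //; apply: MV.
have MX a x n : M (a, x) -> M (a ^+ n, x ^+ n).
  by move=> Ma; elim: n => [|n IH]; rewrite ?expg0 // !expgS; apply: MM.
have Mf a x y : M (a, x) -> M (a, y) -> x = y.
  by move=> Mx My; apply/divg1_eq/M1; rewrite -(mulgV a); apply: MB.
have [q Qq qE] : exists2 q, Q q & forall n z, M (g ^+ n, z) -> z = q ^+ n.
  have [[n [z [n0 Mz]]]|no] := pselect (exists n z, 0 < n /\ M (g ^+ n, z)); last first.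
    exists 1 => // n z Mz; rewrite expg1n; case: n Mz => [|n] Mz; first exact: M1.
    by case: no; exists n.+1, z.
  pose P k := `[< 0 < k /\ exists z, M (g ^+ k, z) >].
  have exP : exists k, P k by exists n; apply/asboolP; split => //; exists z.
  case: (ex_minnP exP) => k /asboolP[k0 [x Mx]] mink {n z n0 Mz exP}.
  have [q Qq eq] := Q_divisible k0 (MQ _ _ Mx); exists q => // n z Mz.
  have Mc := MX _ _ (n %/ k) Mx; rewrite -expgnA in Mc.
  have Mr : M (g ^+ (n %% k), (x ^+ (n %/ k))^-1 * z).
    have -> : g ^+ (n %% k) = (g ^+ (k * (n %/ k)))^-1 * g ^+ n.
      have -> : g ^+ n = g ^+ (k * (n %/ k)) * g ^+ (n %% k).
        by rewrite -expgnDr mulnC -divn_eq.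
      by rewrite mulKg.
    by apply: MM => //; apply: MV.
  have r0 : (n %% k = 0)%N.
    apply/eqP; rewrite -leqn0 leqNgt; apply/negP => r0.
    have : P (n %% k) by apply/asboolP; split => //; eexists; exact: Mr.
    by move/mink; rewrite leqNgt ltn_pmod.
  rewrite r0 expg0 in Mr; have := M1 _ Mr => /(canRL (mulVKg _)).
  have en : n = (k * (n %/ k))%N by rewrite mulnC {1}(divn_eq n k) r0 addn0.
  by rewrite mulg1 -eq -expgnA -en.
have Qc y z : Q y -> y * z = z * y by move=> Qy; apply: Q_central.
have QX n : Q (q ^+ n) by elim: n => [//|n IH]; rewrite expgS; apply: subgroupM.
(* The pairs (g^m, q^m) for integers m, written as k - l with natural exponents. *)
pose C (pr : G * H) := exists k l, pr.1 = g ^+ k * g ^- l /\ pr.2 = q ^+ k * q ^- l.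
have CB p r p' r' : C (p, r) -> C (p', r') -> C (p * p'^-1, r * r'^-1).
  move=> [k [l /= [-> ->]]] [k' [l' /= [-> ->]]]; exists (k + l')%N, (l + k')%N.
  have e (K : groupType) (z : K) :
      z ^+ k * z ^- l * (z ^+ k' * z ^- l')^-1 = z ^+ (k + l') * z ^- (l + k').
    rewrite invgM invgK -!mulgA (mulgA (z ^- l)).
    rewrite -(commuteV (commuteX2 l' l (commute_refl z))).
    by rewrite [(l + k')%N]addnC !expgnDr invgM !mulgA.
  by rewrite !e.
pose M' := [set bz : G * H | exists a x p r,
  [/\ M (a, x), C (p, r), bz.1 = a * p & bz.2 = x * r]].
have CQ p r : C (p, r) -> Q r.
  by move=> [k [l /= [_ ->]]]; apply: subgroupM => //; apply: subgroupV.
have C1 : C (1, 1) by exists 0, 0; split; rewrite /= !expg0 mulgV.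
exists M'; split.
- by move=> [a x] Ma; exists a, x, 1, 1; split; rewrite // mulg1.
- split.
  + move=> _ _ [a [x [p [r [Ma Cp /= _ ->]]]]].
    by apply: subgroupM => //; [apply: MQ Ma|apply: CQ Cp].
  + move=> _ _ _ _ [a [x [p [r [Ma Cp /= -> ->]]]]] [b [y [p' [r' [Mb Cp' /= -> ->]]]]].
    (* Moving the power of g to the right costs a commutator, which lies in the domain with value
       1. *)
    exists (a * b^-1 * [~ b^-1, (p * p'^-1)^-1]), (x * y^-1), (p * p'^-1), (r * r'^-1).
    split; [|exact: CB| |] => /=.
    * by rewrite -[x * y^-1]mulg1; exact: MM (MB _ _ _ _ Ma Mb) (bc _ (derivedR _ _)).
    * by rewrite commgEl; grp.
    rewrite invgM -!mulgA; congr (_ * _).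
    by rewrite (Qc (y^-1)) ?mulgA //; apply: subgroupV => //; apply: MQ Mb.
  + move=> _ [a [x [p [r [Ma [k [l /= [-> ->]]] /= e ->]]]]].
    case: (leqP l k) => lk.
      have := MV _ _ Ma; rewrite -expgnFr // in e *.
      have -> : a^-1 = g ^+ (k - l) by apply/mulg1_eq/esym.
      by move/qE; rewrite -expgnFr // => <-; rewrite mulgV.
    have eV (K : groupType) (z : K) : z ^+ k * z ^- l = z ^- (l - k).
      by rewrite expgnFr ?(ltnW lk) // invgM invgK.
    rewrite !eV in e *; rewrite (divg1_eq (esym e)) in Ma.
    by rewrite (qE _ _ Ma) mulgV.
exists q; exists 1, 1, g, q; split=> //=; rewrite ?mul1g //.
by exists 1%N, 0; split; rewrite /= expg0 invg1 mulg1 expg1.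
Qed.

Lemma divisible_retraction : exists rho : G -> H, [/\ {morph rho : x y / x * y},
  forall x, Q (rho x) & forall q, Q q -> rho (iota q) = q].
Proof.
have bP := base_hom_partial.
(* Taking the union with [base_hom] in the predicate forces extensions of it, whereas a condition of
   containing it would fail for the empty chain. *)
have [|M0 [PM maxM]] := @Zorn_bigcup (G * H)%type (fun M => partial_hom (M `|` base_hom)).
  move=> S SP tot; pose U := \bigcup_(X in S) X.
  have two ax bY : (U `|` base_hom) ax -> (U `|` base_hom) bY ->
      exists M, [/\ partial_hom M, M `<=` U `|` base_hom, M ax & M bY].
    have sub N : S N -> N `|` base_hom `<=` U `|` base_hom.
      by move=> SN x [Nx|]; [left; exists N|right].
    move=> [[N SN Nx]|bx] [[N' SN' Nx']|bx'].
    - have [sN|sN] := tot _ _ SN SN'.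
        by exists (N' `|` base_hom); split; [exact: SP|exact: sub|left; apply: sN|left].
      by exists (N `|` base_hom); split; [exact: SP|exact: sub|left|left; apply: sN].
    - by exists (N `|` base_hom); split; [exact: SP|exact: sub|left|right].
    - by exists (N' `|` base_hom); split; [exact: SP|exact: sub|right|left].
    - by exists base_hom; split => //; right.
  split=> [a x ax|a x b y ax byy|x x1].
  - by have [M [[MQ _ _] _ Max _]] := two _ _ ax ax; apply: MQ Max.
  - by have [M [[_ MB _] sM Max Mby]] := two _ _ ax byy; apply/sM/MB.
  - by have [M [[_ _ M1] _ Mx _]] := two _ _ x1 x1; apply: M1.
pose M := M0 `|` base_hom; have bM : base_hom `<=` M by right.
have total g : exists x, M (g, x).
  apply: contrapT => no; have [M' [MM' PM' [x M'x]]] := partial_hom_extend bM PM g.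
  apply: (maxM M').
    split; first by move=> y M0y; apply: MM'; left.
    by move=> M'M; apply: no; exists x; left; apply: M'M.
  suff -> : M' `|` base_hom = M' by [].
  by apply/seteqP; split => y; [case=> // by_; apply/MM'/bM|left].
have [rho rhoM] := choice total; have [MQ MB M1] := PM.
have Mf a x y : M (a, x) -> M (a, y) -> x = y.
  by move=> Mx My; apply/divg1_eq/M1; rewrite -(mulgV a); apply: MB.
have M11 : M (1, 1).
  by apply: bM; split => //=; exists 1; rewrite ?multiplicative1 ?mulg1.
have MV a : M (a^-1, (rho a)^-1).
  by have := MB _ _ _ _ M11 (rhoM a); rewrite !mul1g.
exists rho; split.
- move=> a b; apply: (Mf (a * b)); first exact: rhoM.
  by have := MB _ _ _ _ (rhoM a) (MV b); rewrite !invgK.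
- by move=> a; apply: MQ (rhoM a).
- move=> q Qq; apply: (Mf (iota q)); first exact: rhoM.
  by apply: bM; split => //=; exists 1; rewrite ?mulg1.
Qed.

End DivisibleExtension.

Lemma subst_subst (I J : choiceType) (K : groupType) (b : J -> K) (c : I -> freeGroup J) w :
  subst b (subst c w) = subst (fun j => subst b (c j)) w.
Proof. exact: (subst_comp (subst b)). Qed.

Lemma kernel_div (G K : groupType) (f : {multiplicative G -> K}) x y :
  f x = 1 -> f y = 1 -> f (x * y^-1) = 1.
Proof. by move=> fx fy; rewrite gmulfM multiplicativeV fx fy invg1 mulg1. Qed.

Lemma kernel_conj (G K : groupType) (f : {multiplicative G -> K}) x g :
  f x = 1 -> f (x ^ g) = 1.
Proof. by move=> fx; rewrite multiplicativeJ fx conj1g. Qed.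

Lemma kernel_mul (G K : groupType) (f : {multiplicative G -> K}) x y :
  f x = 1 -> f y = 1 -> f (x * y) = 1.
Proof. by move=> fx fy; rewrite gmulfM fx fy mulg1. Qed.

(** * Solutions modulo Q *)

Section AdmissibleWords.
Variables (H A : groupType) (p : {multiplicative H -> A}).
Variables (r : nat) (IA : freeGroup 'I_r) (A_law : satisfies_law A IA).

Definition one_var_letter (K : groupType) (y : K) (c : verbal_group IA H -> K)
  (s : infinite_cyclic + verbal_group IA H) : K :=
  match s with inl a => subst (fun=> y) a | inr h => c h end.

Lemma eval_atE g E :
  @eval_at H r IA g E = eval_word (one_var_letter g val) (repr E).
Proof. by []. Qed.

Lemma law_verbal (K : groupType) (f : {multiplicative K -> A}) x :
  verbal IA K x -> f x = 1.
Proof.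
apply: (@generated_ind _ _ (fun x => f x = 1)) => [|u v fu fv|_ [c _ <-]].
- exact: multiplicative1.
- exact: kernel_div fu fv.
by rewrite subst_comp A_law.
Qed.

(** After p all coefficients become 1, so evaluation is a homomorphism again; it kills the normal
    closure of the coefficients and, by the law, the values of I_A on <x>. *)
Lemma admissible_kernel (E : one_var_words H IA) (y : H) (c : verbal_group IA H -> H) :
  admissible E -> (forall h, p (c h) = 1) ->
  p (eval_word (one_var_letter y c) (repr E)) = 1.
Proof.
move=> aE c1; rewrite (eval_word_morph _ _ (gmulfM (s := p))).
pose one : {multiplicative verbal_group IA H -> A} := @one_fun (verbal_group IA H) A.
have -> : eval_word (fun s => p (one_var_letter y c s)) (repr E) =
    fp_lift (subst (fun=> p y)) one E.
  apply: eq_eval_word => -[[a|h] b] _ /=; last exact: c1.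
  by rewrite subst_comp.
pose f : {multiplicative one_var_words H IA -> A} := fp_lift (subst (fun=> p y)) one.
move: E aE; apply: (@generated_ind _ _ (fun E => f E = 1)) => [|u v fu fv|].
- exact: multiplicative1.
- exact: kernel_div fu fv.
move=> _ [_ [a va <-] [b nb <-]]; apply: kernel_mul.
  by rewrite /f /= fp_lift_inl; apply: law_verbal va.
apply: (nb [set E | f E = 1]); split; last first.
  by move=> _ [h _ <-]; rewrite /f /= fp_lift_inr.
split; last by move=> u g; apply: kernel_conj.
apply/subgroupP; split; [exact: multiplicative1|exact: kernel_div].
Qed.

End AdmissibleWords.

Section Enforcing.
Variables (H F A : groupType) (phi : {multiplicative F -> H}) (p : {multiplicative H -> A}).
Hypotheses (exact_FHA : short_exact phi p) (F_free : is_free F) (F_nonab : non_abelian F).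
Variables (r : nat) (IA : freeGroup 'I_r).
Hypotheses (IA_neq1 : IA <> 1) (A_law : satisfies_law A IA).
Variables (G : groupType) (iota : {multiplicative H -> G}).
Hypothesis iota_closed : verbally_closed iota.
Variables (n : nat) (g : 'I_n -> G).

(* Elements of H are variables too, as verbal equations have no coefficients. *)
Definition var : choiceType := ('I_n + H)%type.
Local Notation L := (freeGroup var).
Definition base (s : var) : G := match s with inl j => g j | inr h => iota h end.
Implicit Types (e : var -> H) (T : L) (t : F) (P : (var -> H) -> Prop).

Definition kernel_word T := forall e, p (subst e T) = 1.
Definition test T t := kernel_word T /\ subst base T = iota (phi t).

(* P follows from prescribing the values of finitely many words that only take
   values in F; the prescribed values are those at the solution in G. *)
Definition enforced P := exists s : seq (L * F),
  (forall q, q \in s -> test q.1 q.2) /\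
  forall e, (forall q, q \in s -> subst e q.1 = phi q.2) -> P e.

Lemma enforced_imp P P' : (forall e, P e -> P' e) -> enforced P -> enforced P'.
Proof. by move=> PP' [s [ts Ps]]; exists s; split => // e /Ps/PP'. Qed.

Lemma enforced_and P P' : enforced P -> enforced P' -> enforced (fun e => P e /\ P' e).
Proof.
move=> [s [ts Ps]] [s' [ts' Ps']]; exists (s ++ s'); split=> [q|e E].
  by rewrite mem_cat => /orP[/ts|/ts'].
by split; [apply: Ps|apply: Ps'] => q qs; apply: E; rewrite mem_cat qs ?orbT.
Qed.

Lemma enforced_all (I : eqType) (s : seq I) (P : I -> (var -> H) -> Prop) :
  (forall k, k \in s -> enforced (P k)) -> enforced (fun e => forall k, k \in s -> P k e).
Proof.
elim: s => [|k s IH] h; first by exists [::]; split.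
have h1 : enforced (P k) by apply: h; apply: mem_head.
have h2 : enforced (fun e => forall k, k \in s -> P k e).
  by apply: IH => j js; apply: h; rewrite inE js orbT.
apply: enforced_imp (enforced_and h1 h2) => e [Pk Ps] j.
by rewrite inE => /orP[/eqP ->//|]; apply: Ps.
Qed.

Lemma enforced_test T t : test T t -> enforced (fun e => subst e T = phi t).
Proof.
move=> tT; exists [:: (T, t)]; split=> [q|e E]; first by rewrite inE => /eqP ->.
by apply: (E (T, t)); rewrite inE.
Qed.

Lemma kernel_phi h : p h = 1 -> exists t, phi t = h.
Proof.
have [_ ker _] := exact_FHA; move=> ph.
have : [set h | p h = 1] h by [].
by rewrite -ker => -[t _ <-]; exists t.
Qed.

Lemma test_value (c : 'I_r -> F) :
  test (subst (fun j => free_gen (inr (phi (c j)) : var)) IA) (subst c IA).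
Proof.
split=> [e|]; first by rewrite !subst_comp A_law.
rewrite subst_subst !subst_comp; congr (subst _ IA).
by apply/funext => j; rewrite subst_gen.
Qed.

(** All tests take values in F at the solution e found in H, so V applies there and yields one
    conjugator u in F; conjugating the whole tuple e undoes it. *)
Lemma enforced_sat P : enforced P -> exists e, P e.
Proof.
have [phi_inj _ _] := exact_FHA.
move=> [s [ts Ps]].
have [c0 c01] := free_nontrivial_value F_free F_nonab IA_neq1.
have [h nch] := free_noncommuting_conjugate F_free F_nonab c01.
rewrite -subst_conj in nch.
have t1 := test_value c0; have t2 := test_value (fun j => c0 j ^ h).
set T1 := subst _ _ in t1; set T2 := subst _ _ in t2.
(* Two values of the law in F are added to provide the non-commuting entries that [free_test_word]
   requires. *)
pose s' := (T1, subst c0 IA) :: (T2, subst (fun j => c0 j ^ h) IA) :: s.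
have ts' q : q \in s' -> test q.1 q.2.
  by rewrite !inE => /or3P[/eqP->|/eqP->|/ts].
pose T k := (tnth (in_tuple s') k).1; pose c k := (tnth (in_tuple s') k).2.
have tT k : test (T k) (c k) by apply: ts'; apply: mem_tnth.
have [V HV] : exists V : freeGroup 'I_(size s'), forall d, subst d V = subst c V ->
    exists u, forall k, d k = c k ^ u.
  apply: (@free_test_word _ F_free F_nonab _ c ord0 (inord 1)).
  by rewrite /c !(tnth_nth (1, 1)) /= inordK.
have [|e Ee] := @verbally_closed_any _ _ _ iota_closed var (subst T V) (phi (subst c V)).
  exists base; rewrite subst_subst !subst_comp; congr (subst _ V).
  by apply/funext => k; have [] := tT k.
have dk k : exists t, phi t = subst e (T k) by apply: kernel_phi; have [+ _] := tT k; apply.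
have [d dE] := boolp.choice dk.
have [|u Hu] := HV d.
  apply: phi_inj; rewrite -Ee subst_subst !subst_comp; congr (subst _ V).
  exact/funext.
exists (fun y => e y ^ (phi u)^-1); apply: Ps => q qs.
have qs' : q \in s' by rewrite !inE qs !orbT.
have /tnthP[k ek] : q \in in_tuple s' by [].
by rewrite subst_conj ek -/(T k) -dE Hu multiplicativeJ conjgK.
Qed.

(** The variable attached to h itself may take values outside F. Writing h through values of the law
    and lifting their arguments gives a word with values in F at every tuple. *)
Lemma liftable_verbal h : verbal IA H h -> exists T, kernel_word T /\ subst base T = iota h.
Proof.
apply: (@generated_ind _ _ (fun h => exists T, kernel_word T /\ subst base T = iota h)).
- by exists 1; split=> [e|]; rewrite ?subst1 ?multiplicative1 // subst1 multiplicative1.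
- move=> u v [T [kT eT]] [T' [kT' eT']]; exists (T * T'^-1); split=> [e|].
    by rewrite substM substV gmulfM multiplicativeV kT kT' invg1 mulg1.
  by rewrite substM substV eT eT' gmulfM multiplicativeV.
move=> _ [c _ <-]; exists (subst (fun j => free_gen (inr (c j) : var)) IA).
split=> [e|]; first by rewrite !subst_comp A_law.
rewrite subst_subst subst_comp; congr (subst _ IA).
by apply/funext => j; rewrite subst_gen.
Qed.

Lemma verbal_group_ker (c : verbal_group IA H) : p (val c) = 1.
Proof. by apply: (law_verbal A_law); exact: set_mem (valP c). Qed.

Variables (Q : set H) (Q_subgroup : subgroup Q) (Q_central : Q `<=` center H).

Lemma lcosetP (a b : H) : lcoset a Q = lcoset b Q -> exists2 q, Q q & a = b * q.
Proof.
move=> e; have : lcoset a Q a.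
  by exists 1; rewrite ?mulg1 //; have /subgroupP[] := Q_subgroup.
by rewrite e => -[q Qq <-]; exists q.
Qed.

Lemma enforced_unique_solution u m (E : 'I_m -> one_var_words H IA) T :
  (forall k, admissible (E k)) -> (exists! C, coset_solution Q u E C) ->
  subst base T = iota u -> enforced (fun e => exists2 q, Q q & subst e T = u * q).
Proof.
move=> aE [C [_ uniqC]] eT.
have lift (c : verbal_group IA H) : exists T, kernel_word T /\ subst base T = iota (val c).
  exact: liftable_verbal (set_mem (valP c)).
have [cw cwP] := boolp.choice lift.
(* E_k with T for x and kernel words for its coefficients: all its values lie in F, although those
   of T need not. *)
pose Tk k := eval_word (one_var_letter T cw) (repr (E k)).
have TkE (K : groupType) (e : var -> K) k :
    subst e (Tk k) = eval_word (one_var_letter (subst e T) (fun c => subst e (cw c))) (repr (E k)).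
  rewrite /Tk (eval_word_morph _ _ (@substM _ _ e)); apply: eq_eval_word => -[[a|c] b] _ //=.
  by rewrite subst_subst.
have enf_letter c : enforced (fun e => subst e (cw c) = val c).
  have [t et] := kernel_phi (verbal_group_ker c).
  rewrite -et; apply: enforced_test; rewrite /test et.
  exact: cwP.
have enf_word k : enforced (fun e => subst e (Tk k) = eval_at u (E k)).
  have [|t et] := @kernel_phi (eval_at u (E k)).
    exact: (admissible_kernel A_law _ (aE k) verbal_group_ker).
  rewrite -et; apply: enforced_test; split=> [e|].
    rewrite TkE; apply: (admissible_kernel A_law) => // c; exact: (cwP c).1.
  rewrite TkE et eval_atE (eval_word_morph _ _ (gmulfM (s := iota))).
  apply: eq_eval_word => -[[a|c] b] _ /=; last exact: (cwP c).2.
  by rewrite eT subst_comp.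
pose letters := flatten [seq [seq q.1 | q <- repr (E k)] | k <- enum 'I_m].
pose letter_ok (s : infinite_cyclic + verbal_group IA H) (e : var -> H) :=
  match s with inl _ => True | inr c => subst e (cw c) = val c end.
have enf1 : enforced (fun e => forall s, s \in letters -> letter_ok s e).
  apply: enforced_all => -[a _|c _]; first by exists [::]; split.
  exact: enf_letter.
have enf2 := enforced_all (s := enum 'I_m) (fun k _ => enf_word k).
apply: enforced_imp (enforced_and enf1 enf2) => e [h1 h2].
(* With the occurring coefficients and all values E_k(u) prescribed exactly, the value of T solves
   the system. *)
apply: lcosetP; rewrite -(uniqC (lcoset u Q)); last by exists u.
symmetry; apply: uniqC; exists (subst e T) => // k.
rewrite -[eval_at u _]h2 ?mem_enum // TkE eval_atE; congr (lcoset _ Q).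
apply: eq_eval_word => -[[a|c] b] cE //=; symmetry.
apply: (h1 (inr c)); apply/flattenP; exists [seq q.1 | q <- repr (E k)].
  by apply: map_f; rewrite mem_enum.
by apply/mapP; exists (inr c, b).
Qed.

Variable U : set H.
Hypotheses (U_gen : generated U = [set: H]).
Hypothesis U_eqns : forall u : H, U u ->
     exists (n : nat) (E : 'I_n -> one_var_words H IA),
       (forall k, admissible (E k)) /\
       exists! C : set H, coset_solution Q u E C.

Lemma enforced_coset h T : subst base T = iota h ->
  enforced (fun e => exists2 q, Q q & subst e T = h * q).
Proof.
pose M h := forall T, subst base T = iota h ->
  enforced (fun e => exists2 q, Q q & subst e T = h * q).
have MU u : U u -> M u.
  by move=> /U_eqns[m [E [aE uE]]] T' eT'; apply: enforced_unique_solution uE eT'.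
have MB x y : M x -> M y -> M (x * y^-1).
  move=> Mx My T' eT'.
  (* If T' lifts x y^-1, then T' times the variable y lifts x, so the claim for x y^-1 follows from
     those for x and y. *)
  have h1 : enforced (fun e => exists2 q, Q q & subst e (T' * free_gen (inr y : var)) = x * q).
    by apply: Mx; rewrite substM subst_gen eT' gmulfM multiplicativeV mulgVK.
  have h2 : enforced (fun e => exists2 q, Q q & subst e (free_gen (inr y : var)) = y * q).
    by apply: My; rewrite subst_gen.
  apply: enforced_imp (enforced_and h1 h2) => e [[q Qq eq] [q' Qq' eq']].
  have sQ := Q_subgroup; exists (q * q'^-1).
    by apply: subgroupM => //; apply: subgroupV.
  apply: (@mulIg _ (subst e (free_gen (inr y : var)))); rewrite -substM eq eq'.
  have Qc := Q_central (subgroupV sQ Qq').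
  by rewrite -!mulgA (mulgA q'^-1) Qc -!mulgA mulVg mulg1 (Q_central Qq) mulKg.
move: h T; apply: (_ : forall h, M h) => h.
(* The identity is reached as u0 u0^-1; with U empty, H would be trivial and F abelian. *)
have [u0 Uu0] : exists u0, U u0.
  apply: contrapT => no; apply: F_nonab => a b.
  have H1 x : x = 1 :> H.
    have : generated U x by rewrite U_gen.
    apply: (@generated_ind _ _ (fun x => x = 1)) => // [? ? -> ->|v Uv]; first by rewrite mulgV.
    by case: no; exists v.
  have [phi_inj _ _] := exact_FHA.
  by apply: phi_inj; rewrite (H1 (phi _)) [RHS]H1.
have : generated U h by rewrite U_gen.
apply: (@generated_ind _ _ M) => //; rewrite -(mulgV u0).
by apply: MB; apply: MU.
Qed.

(** The coefficients are variables too, so they are enforced along with the left-hand sides. As Q is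
    central, replacing their values by the true coefficients changes each left-hand side only by an
    element of Q. *)
Lemma solution_mod m (w : 'I_m -> freeProd (freeGroup 'I_n) H) :
  (forall k, eval_eqn iota g (w k) = 1) ->
  exists x : 'I_n -> H, forall k, Q (eval_eqn id x (w k)).
Proof.
move=> sol; have sQ := Q_subgroup; have cQ := Q_central.
pose wl (s : freeGroup 'I_n + H) : L :=
  match s with inl a => subst (fun j => free_gen (inl j : var)) a | inr h => free_gen (inr h : var) end.
pose W k := eval_word wl (repr (w k)).
have enf1 k : enforced (fun e => exists2 q, Q q & subst e (W k) = 1 * q).
  apply: enforced_coset; rewrite multiplicative1 -(sol k) /W.
  rewrite (eval_word_morph _ _ (@substM _ _ base)); apply: eq_eval_word => -[[a|h] b] _ /=.
    rewrite subst_subst; congr (subst _ a); apply/funext => j.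
    by rewrite subst_gen.
  by rewrite subst_gen.
pose letters := flatten [seq [seq q.1 | q <- repr (w k)] | k <- enum 'I_m].
pose letter_ok (s : freeGroup 'I_n + H) (e : var -> H) :=
  match s with inl _ => True | inr h => exists2 q, Q q & e (inr h) = h * q end.
have enf2 : enforced (fun e => forall s, s \in letters -> letter_ok s e).
  apply: enforced_all => -[a _|h _]; first by exists [::]; split.
  have := @enforced_coset h (free_gen (inr h : var)); rewrite subst_gen => /(_ erefl).
  by apply: enforced_imp => e; rewrite subst_gen.
have enf3 := enforced_all (s := enum 'I_m) (fun k _ => enf1 k).
have [e [h1 h2]] := enforced_sat (enforced_and enf2 enf3).
exists (fun j => e (inl j)) => k.
have [q Qq eq] := h2 k (mem_enum _ k).
have [|q' Qq' eq'] := @eval_word_mod _ _ Q (fun s => match s with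
    inl a => subst (fun j => e (inl j)) a | inr h => h end)
    (fun s => match s with inl a => subst (fun j => e (inl j)) a | inr h => e (inr h) end)
    (repr (w k)) sQ cQ.
  move=> [[a|h] b] lw /=; first by exists 1; [have /subgroupP[] := sQ|rewrite mulg1].
  apply: (h1 (inr h)); apply/flattenP; exists [seq q.1 | q <- repr (w k)].
    by apply: map_f; rewrite mem_enum.
  by apply/mapP; exists (inr h, b).
have eW : subst e (W k) = eval_word (fun s => match s with
    inl a => subst (fun j => e (inl j)) a | inr h => e (inr h) end) (repr (w k)).
  rewrite /W (eval_word_morph _ _ (@substM _ _ e)); apply: eq_eval_word => -[[a|h] b] _ /=.
    rewrite subst_subst; congr (subst _ a); apply/funext => j.
    by rewrite subst_gen.
  by rewrite subst_gen.
have -> : eval_eqn id (fun j => e (inl j)) (w k) = q * q'^-1.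
  by apply: (@mulIg _ q'); rewrite mulgVK -[RHS]mul1g -eq eW eq'.
by apply: subgroupM => //; apply: subgroupV.
Qed.

End Enforcing.

Theorem mainTheorem1
  (H : groupType)
  (F A : groupType)
  (i : {multiplicative F -> H}) (p : {multiplicative H -> A})
  (exact_FHA : short_exact i p)
  (F_free : is_free F) (F_nonab : non_abelian F)
  (r : nat) (IA : freeGroup 'I_r)
  (IA_neq1 : IA <> 1) (A_law : satisfies_law A IA)
  (Q : set H)
  (Q_subgroup : subgroup Q) (Q_divisible : divisible Q)
  (Q_central : Q `<=` center H) (Q_derived : Q `&` derived H = [set 1])
  (U : set H)
  (U_gen : generated U = [set: H]) (U_inv : [set u^-1 | u in U] = U)
  (U_eqns : forall u : H, U u ->
     exists (n : nat) (E : 'I_n -> one_var_words H IA),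
       (forall k, admissible (E k)) /\
       exists! C : set H, coset_solution Q u E C) :
  strongly_verbally_closed H.
Proof.
move=> G iota iota_inj iota_closed n m w [g sol].
have [x Qx] := solution_mod exact_FHA F_free F_nonab IA_neq1 A_law iota_closed
  Q_subgroup Q_central U_gen U_eqns sol.
have [rho [rhoM Qrho rhoQ]] : exists rho : G -> H, [/\ {morph rho : x y / x * y},
    forall x, Q (rho x) & forall q, Q q -> rho (iota q) = q].
  apply: divisible_retraction => // q Qq /(verbally_closed_derived iota_closed) Dq.
  have : (Q `&` derived H) q by [].
  by rewrite Q_derived.
(* Chosen so that [rho] takes equal values at iota (x_j t_j) and at g_j. *)
pose t j := rho (g j) * (rho (iota (x j)))^-1.
have Qt j : Q (t j) by apply: subgroupM => //; apply: subgroupV.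
exists (fun j => x j * t j) => k; set E := eval_eqn _ _ _.
have QE : Q E.
  have [|q Qq eq] := @eval_word_mod _ _ Q (fun s => match s with
      inl a => subst x a | inr h => h end)
      (fun s => match s with inl a => subst (fun j => x j * t j) a | inr h => h end)
      (repr (w k)) Q_subgroup Q_central.
    move=> [[a|h] b] _ /=.
      apply: (@eval_word_mod _ _ Q x (fun j => x j * t j)) => // q _.
      by exists (t q.1).
    by exists 1; [have /subgroupP[] := Q_subgroup|rewrite mulg1].
  by rewrite /E /eval_eqn /fp_lift /pres_lift eq; exact: subgroupM Q_subgroup (Qx k) Qq.
have rho1 : rho 1 = 1 by apply: (@mulgI _ (rho 1)); rewrite -rhoM !mulg1.
(* As E lies in Q, it equals rho (iota E), which agrees letter by letter with the image under [rho]
   of the equation solved by g. *)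
rewrite -(rhoQ _ QE) -[RHS]rho1 -(sol k) /E /eval_eqn /fp_lift /pres_lift.
rewrite (eval_word_morph _ _ (gmulfM (s := iota))) !(eval_word_morph _ _ rhoM).
apply: eq_eval_word => -[[a|h] b] _ //=.
rewrite /subst /pres_lift (eval_word_morph _ _ (gmulfM (s := iota))).
rewrite !(eval_word_morph _ _ rhoM); apply: eq_eval_word => q _.
rewrite gmulfM rhoM (rhoQ _ (Qt _)) /t.
by rewrite mulgA (Q_central _ (Qrho (iota _))) mulgK.
Qed.
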